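(* Let $n>1$ be an odd integer. For integers $k\geq 0$ define $$c_q(k)=(-1)^k\frac{(1+q^{4k+1})(q^{2};q^{4})^2_k}{(1+q)(q^{4};q^{4})^2_k}q^{2k^2+k}.$$ Then, modulo $\Phi_n(-q)^3\Phi_n(q)^2$, $$\sum_{k=0}^{n-1}\sum_{j=0}^{k}c_q(j)c_q(k-j)\equiv [n]^2_{q^2}\,q^{(n-1)^2}\bigg(\sum_{k=0}^{\frac{n-1}{2}}\frac{(q^{2};q^{4})_k}{[4k+1](q^{4};q^{4})_k}q^{2k}\bigg)^2.$$
   Context: Here $q$ is an indeterminate. The $q$-shifted factorial is $(a;q)_0=1$, $(a;q)_m=(1-a)(1-aq)\cdots(1-aq^{m-1})$ for $m\geq1$, and $(a_1,\dots,a_s;q)_m=(a_1;q)_m\cdots(a_s;q)_m$. The $q$-integer is $[m]=[m]_q=1+q+\cdots+q^{m-1}$, and $[m]_{q^2}=1+q^2+\cdots+q^{2(m-1)}$. $\Phi_n(q)$ denotes the $n$-th cyclotomic polynomial in $q$. A congruence between rational functions in $q$ modulo a polynomial $P(q)$ means that the numerator of the difference (in reduced form) is divisible by $P(q)$ while its denominator is coprime to $P(q)$. *)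

(* Defs.v *)
From HB Require Import structures.
From mathcomp Require Import all_boot all_order all_algebra all_field.
Set Implicit Arguments.
Unset Strict Implicit.
Unset Printing Implicit Defensive.
Import GRing.Theory.
Local Open Scope ring_scope.

Notation ratfun := {fraction {poly rat}}.

Definition qvar : ratfun := tofrac ('X : {poly rat}).

Definition qpoch (F : fieldType) (a q : F) (m : nat) : F :=
  \prod_(i < m) (1 - a * q ^+ i).

Definition qint (F : fieldType) (q : F) (m : nat) : F := \sum_(i < m) q ^+ i.

Definition Phi (n : nat) : {poly rat} := map_poly intr 'Phi_n.

Definition PhiN (n : nat) : {poly rat} := Phi n \Po (- 'X).

(* [u / v] is the reduced form of [f - g]; it is unique up to a common nonzero
   scalar, which affects neither divisibility nor coprimality. *)
Definition ratfun_congr (P : {poly rat}) (f g : ratfun) : Prop :=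
  exists u v : {poly rat},
    [/\ v != 0, coprimep u v, f - g = tofrac u / tofrac v, P %| u
      & coprimep v P].

Definition cq (k : nat) : ratfun :=
  let q := qvar in
  (-1) ^+ k *
  (((1 + q ^+ (4 * k + 1)) * qpoch (q ^+ 2) (q ^+ 4) k ^+ 2) /
   ((1 + q) * qpoch (q ^+ 4) (q ^+ 4) k ^+ 2)) *
  q ^+ (2 * k ^ 2 + k).

(* Main.v *)
Require Import Defs.
From HB Require Import structures.
From mathcomp Require Import all_boot all_order all_algebra all_field.
From mathcomp Require Import ring zify.
Import GRing.Theory.
Local Open Scope ring_scope.

(* Write n = 2N + 1, w = q^(2n), S = c(0) + ... + c(N) and let R be the square
   root of the right-hand side read off from the statement.  A Bailey
   pair relative to (q^2, q^4), inserted in the Bailey lemma with parameters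
   q^2/w = (q^4)^(-N) and q^2 w, gives an exact identity whose two sides become
   S and (-1)^N R when w is set to 1 in the shifted factorials.  Since
     (1 - x/w)(1 - xw) = (1 - x)^2 - x(1 - w)^2/w,
   this replacement only matters modulo (1 - w)^2, so S = (-1)^N R modulo
   Phi_n(q)^2 Phi_n(-q)^2.  The double sum is S^2 plus twice the sum of
   c(i) c(j) over i > N, i + j < n, where c(i) is divisible by (1 - w)^2; this
   settles the modulus Phi_n(q)^2.  Modulo Phi_n(-q) one has q^n = -1, R = 0, and
   the reflections c(N - k) = -c(k) and, after division by (1 - w)^2,
   c(3N + 1 - i) = -c(i).  Hence S^2 = R^2 modulo Phi_n(-q)^3, and the
   remaining terms cancel in pairs modulo Phi_n(-q)^3. *)

(** * The q-Chu-Vandermonde sum and a Bailey pair *)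

Lemma qpoch0 (F : fieldType) (a p : F) : qpoch a p 0 = 1.
Proof. by rewrite /qpoch big_ord0. Qed.

Lemma qpochSr (F : fieldType) (a p : F) (m : nat) :
  qpoch a p m.+1 = qpoch a p m * (1 - a * p ^+ m).
Proof. by rewrite /qpoch big_ord_recr. Qed.

Lemma qpochD (F : fieldType) (a p : F) (m k : nat) :
  qpoch a p (m + k) = qpoch a p m * qpoch (a * p ^+ m) p k.
Proof.
elim: k => [|k IHk]; first by rewrite addn0 qpoch0 mulr1.
by rewrite addnS !qpochSr IHk exprD !mulrA.
Qed.

Lemma qpochS (F : fieldType) (a p : F) (m : nat) :
  qpoch a p m.+1 = (1 - a) * qpoch (a * p) p m.
Proof. by rewrite -add1n qpochD qpochSr qpoch0 mul1r expr1 expr0 mulr1. Qed.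

Lemma qpoch_neq0 (F : fieldType) (a p : F) (m : nat) :
  (forall i, (i < m)%N -> 1 - a * p ^+ i != 0) -> qpoch a p m != 0.
Proof. by move=> h; apply/prodf_neq0 => i _; apply: h. Qed.

Lemma qpoch_Vexp_eq0 (F : fieldType) (p : F) (m k : nat) :
  p != 0 -> (m < k)%N -> qpoch (p ^+ m)^-1 p k = 0.
Proof.
move=> p0 lt_mk; rewrite -(subnKC lt_mk) qpochD qpochSr mulVf ?expf_neq0 //.
by rewrite subrr mulr0 mul0r.
Qed.

Section QChu.
Variables (F : fieldType) (p b d : F).
Hypotheses (p0 : p != 0) (hp : forall i, 1 - p * p ^+ i != 0)
  (hc : forall i, 1 - b * d * p ^+ i != 0).

(** The parameter [x] stands for [p ^+ m]; keeping it free turns the step from [m] to [m.+1] into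
    the step from [x] to [p * x]. *)
Let t x i := qpoch x^-1 p i * qpoch b p i * (d * x) ^+ i
             / (qpoch p p i * qpoch (b * d) p i).

(* The Wilf-Zeilberger pair behind the q-Chu-Vandermonde sum. *)
Let q_chu_telescope x k : x != 0 ->
  \sum_(i < k.+1) ((1 - b * d * x) * t (p * x) i - (1 - d * x) * t x i)
  = x * d * (1 - b * p ^+ k) * t x k.
Proof.
move=> x0; have tS j : t x j.+1 = t x j * ((1 - x^-1 * p ^+ j) * (1 - b * p ^+ j) * (d * x)
      / ((1 - p * p ^+ j) * (1 - b * d * p ^+ j))).
  by rewrite /t !qpochSr exprSr !invfM; ring.
have tpS j : t (p * x) j.+1 =
    t x j * ((1 - (p * x)^-1) * (1 - b * p ^+ j) * (d * p * x) * p ^+ j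
      / ((1 - p * p ^+ j) * (1 - b * d * p ^+ j))).
  rewrite /t [qpoch (p * x)^-1 _ _]qpochS.
  have -> : (p * x)^-1 * p = x^-1 by field; rewrite x0 p0.
  by rewrite !qpochSr exprSr !invfM !exprMn; ring.
elim: k => [|k IHk].
  by rewrite big_ord1 /t !qpoch0 !expr0; field; rewrite oner_neq0.
rewrite big_ord_recr /= IHk tS tpS exprS.
have := hp k; have := hc k; have := expf_neq0 k p0.
move: (p ^+ k) (t x k) => y u y0 h1 h2.
by field; rewrite h1 h2 x0 p0.
Qed.

(** At [x = p ^+ m], summing the telescoped relation over [i <= m.+1] kills its boundary term. What
    remains is a first-order recurrence: [1 - b * d * p ^+ m] times the sum of order [m.+1] equals
    [1 - d * p ^+ m] times the sum of order [m]. *)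
Lemma q_chu_vandermonde m :
  \sum_(i < m.+1) qpoch (p ^+ m)^-1 p i * qpoch b p i * (d * p ^+ m) ^+ i
     / (qpoch p p i * qpoch (b * d) p i)
  = qpoch d p m / qpoch (b * d) p m.
Proof.
change (\sum_(i < m.+1) t (p ^+ m) i = qpoch d p m / qpoch (b * d) p m).
elim: m => [|m IHm].
  by rewrite big_ord1 /t !qpoch0 expr0 !mulr1 divr1.
have x0 := expf_neq0 m p0.
have t0 : t (p ^+ m) m.+1 = 0 by rewrite /t qpoch_Vexp_eq0 // !mul0r.
have := q_chu_telescope _ m.+1 x0.
rewrite t0 mulr0 sumrB -!mulr_sumr [X in _ - _ * X]big_ord_recr /= t0 addr0.
rewrite IHm -exprS => /eqP; rewrite subr_eq0 => /eqP h.
have hm := hc m; have hq := @qpoch_neq0 F (b * d) p m (fun i _ => hc i).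
apply: (mulfI hm); rewrite h !qpochSr; field.
by rewrite hm hq.
Qed.

End QChu.

(* The sum is indefinitely summable, so no induction on the order is needed. *)
Lemma bailey_pair_telescope (F : fieldType) (p c d x : F) (k : nat) :
  x != 0 -> (forall i, 1 - d * p ^+ i != 0) -> 1 - d * x != 0 ->
  (forall i, 1 - c * d * p * x * p ^+ i != 0) ->
  \sum_(r < k.+1) (1 - c * d * p ^+ r ^+ 2) * qpoch c p r * qpoch x^-1 p r
      * (d * x) ^+ r / (qpoch (d * p) p r * qpoch (c * d * p * x) p r)
  = ((1 - d) * (1 - c * d * x)
     - qpoch x^-1 p k.+1 * qpoch c p k.+1 * (d * x) ^+ k.+1
       / (qpoch (d * p) p k * qpoch (c * d * p * x) p k)) / (1 - d * x).
Proof.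
move=> x0 hd hdx hA; elim: k => [|k IHk].
  rewrite big_ord1 !qpochSr !qpoch0 !expr0 expr1; field.
  by rewrite hdx x0 oner_neq0.
rewrite big_ord_recr /= IHk !qpochSr [(d * x) ^+ k.+2]exprSr exprS.
have := hA k; have := hd k.+1; rewrite exprS mulrA.
have hP : qpoch (d * p) p k != 0.
  by apply: qpoch_neq0 => i _; rewrite -mulrA -exprS.
have hQ := @qpoch_neq0 F (c * d * p * x) p k (fun i _ => hA i).
move: (qpoch (d * p) p k) (qpoch (c * d * p * x) p k) hP hQ => P Q hP hQ.
move: (qpoch c p k) (qpoch x^-1 p k) ((d * x) ^+ k) (p ^+ k) => C X D y h1 h2.
by field; rewrite h1 h2 hP hQ x0 hdx.
Qed.

Lemma sum_triangle (V : nmodType) (f : nat -> nat -> V) (m : nat) :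
  \sum_(j < m) \sum_(r < j.+1) f r (j - r)%N = \sum_(r < m) \sum_(i < m - r) f r i.
Proof.
elim: m => [|m IHm]; first by rewrite !big_ord0.
rewrite big_ord_recr /= IHm [RHS]big_ord_recr /= subSnn big_ord1.
rewrite [X in _ + X]big_ord_recr /= subnn addrA -big_split /=; congr (_ + _).
apply: eq_bigr => r _; have r_lt := ltn_ord r.
by rewrite subSn ?(ltnW r_lt) // big_ord_recr.
Qed.

(** Each factor obeys [p ^+ m - p ^+ i = - p ^+ i * (1 - p ^+ (m - i))], and the factors
    [1 - p ^+ (m - i)] complete [qpoch p p (m - r)] to [qpoch p p m]. *)
Lemma qpoch_Vexp (F : fieldType) (p : F) (m r : nat) : p != 0 -> (r <= m)%N ->
  qpoch (p ^+ m)^-1 p r * (p ^+ m) ^+ r * qpoch p p (m - r)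
  = (-1) ^+ r * p ^+ 'C(r, 2) * qpoch p p m.
Proof.
move=> p0; elim: r => [|r IHr] le_rm; first by rewrite qpoch0 !expr0 subn0; ring.
rewrite binS bin1 exprD [(-1) ^+ _]exprS qpochSr [_ ^+ r.+1]exprSr.
have -> : -1 * (-1) ^+ r * (p ^+ 'C(r, 2) * p ^+ r) * qpoch p p m
  = - p ^+ r * ((-1) ^+ r * p ^+ 'C(r, 2) * qpoch p p m) by ring.
rewrite -IHr ?(ltnW le_rm) //.
have -> : (m - r = (m - r.+1).+1)%N by lia.
rewrite qpochSr.
have -> : p ^+ m = p * p ^+ (m - r.+1) * p ^+ r.
  by rewrite -exprS -exprD; congr (_ ^+ _); lia.
have := expf_neq0 r p0; have := expf_neq0 (m - r.+1) p0.
move: (qpoch (p * p ^+ (m - r.+1) * p ^+ r)^-1 p r) (qpoch p p (m - r.+1)) (p ^+ (m - r.+1)) => P Q v hv.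
move: (p ^+ r) => w hw; move: ((p * v * w) ^+ r) => u.
by field; rewrite hw hv p0.
Qed.

(** A Bailey pair relative to [(c * d, p)]. It is the indefinite sum above at [x = p ^+ m] and
    [k = m], where the boundary term contains a vanishing shifted factorial. *)
Lemma bailey_pair (F : fieldType) (p c d : F) (m : nat) :
  p != 0 -> (forall i, 1 - d * p ^+ i != 0) -> (forall i, 1 - p * p ^+ i != 0) ->
  (forall i, 1 - c * d * p * p ^+ i != 0) ->
  \sum_(r < m.+1) (1 - c * d * p ^+ r ^+ 2) * qpoch c p r * (-1) ^+ r
      * p ^+ 'C(r, 2) * d ^+ r / qpoch (d * p) p r
      / (qpoch p p (m - r) * qpoch (c * d * p) p (m + r))
  = (1 - d) * (1 - c * d * p ^+ m)
    / ((1 - d * p ^+ m) * qpoch p p m * qpoch (c * d * p) p m).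
Proof.
move=> p0 hd hp hA; have x0 := expf_neq0 m p0.
have hP := @qpoch_neq0 F p p m (fun i _ => hp i).
have hQ := @qpoch_neq0 F (c * d * p) p m (fun i _ => hA i).
have := @bailey_pair_telescope F p c d (p ^+ m) m x0 hd (hd m) _.
rewrite qpoch_Vexp_eq0 // !mul0r subr0 => /(_ _) h.
transitivity ((1 - d) * (1 - c * d * p ^+ m) / (1 - d * p ^+ m)
              / (qpoch p p m * qpoch (c * d * p) p m)); last first.
  by rewrite !invfM; ring.
rewrite -h => [|i]; last by rewrite -mulrA -exprD.
rewrite mulr_suml; apply: eq_bigr => r _.
have r_le : (r <= m)%N by rewrite -ltnS.
have hR := @qpoch_neq0 F p p (m - r) (fun i _ => hp i).
(* This trades the terminating symbol for the [1 / qpoch p p (m - r)] of a Bailey pair. *)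
have E : (-1) ^+ r * p ^+ 'C(r, 2) / qpoch p p (m - r) =
         qpoch (p ^+ m)^-1 p r * (p ^+ m) ^+ r / qpoch p p m.
  apply: (mulIf hR); rewrite mulfVK //.
  by rewrite mulrAC qpoch_Vexp // mulfK.
rewrite qpochD !invfM exprMn.
transitivity ((-1) ^+ r * p ^+ 'C(r, 2) / qpoch p p (m - r) *
   ((1 - c * d * p ^+ r ^+ 2) * qpoch c p r * d ^+ r / qpoch (d * p) p r
      / qpoch (c * d * p) p m / qpoch (c * d * p * p ^+ m) p r)); first by ring.
by rewrite E; ring.
Qed.

(* Reversing the order of summation turns the inner sum into a
   q-Chu-Vandermonde sum. *)
Lemma bailey_lemma (F : fieldType) (p A rho e : F) (alpha : nat -> F) (m : nat) :
  p != 0 -> rho * e = A * p -> (forall i, 1 - p * p ^+ i != 0) ->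
  (forall i, 1 - A * p * p ^+ i != 0) ->
  (forall i, (i < m)%N -> 1 - e * p ^+ i != 0) ->
  \sum_(j < m.+1) qpoch (p ^+ m)^-1 p j * qpoch rho p j * (e * p ^+ m) ^+ j
     * (\sum_(r < j.+1) alpha r / (qpoch p p (j - r) * qpoch (A * p) p (j + r)))
  = qpoch e p m / qpoch (A * p) p m *
    \sum_(r < m.+1) qpoch (p ^+ m)^-1 p r * qpoch rho p r * (e * p ^+ m) ^+ r
       / (qpoch e p r * qpoch (A * p * p ^+ m) p r) * alpha r.
Proof.
move=> p0 re hp hA he.
pose f r i := qpoch (p ^+ m)^-1 p (r + i) * qpoch rho p (r + i)
   * (e * p ^+ m) ^+ (r + i) * (alpha r / (qpoch p p i * qpoch (A * p) p (r + i + r))).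
transitivity (\sum_(j < m.+1) \sum_(r < j.+1) f r (j - r)%N).
  apply: eq_bigr => j _; rewrite mulr_sumr; apply: eq_bigr => r _.
  by rewrite /f subnKC // -ltnS.
rewrite sum_triangle mulr_sumr; apply: eq_bigr => r _.
have r_le : (r <= m)%N by rewrite -ltnS.
have hA' k : A * p * p ^+ (r + r + k) = rho * p ^+ r * (e * p ^+ r) * p ^+ k.
  by rewrite !exprD -re; ring.
have hre i : 1 - rho * p ^+ r * (e * p ^+ r) * p ^+ i != 0 by rewrite -hA'.
(* The inner sum over [i = j - r] has order [m - r] and parameters shifted by [p ^+ r]; the relation
   [rho * e = A * p] gives its denominator parameter the required product form. *)
have h := q_chu_vandermonde F p (rho * p ^+ r) (e * p ^+ r) p0 hp hre (m - r).
transitivity (qpoch (p ^+ m)^-1 p r * qpoch rho p r * (e * p ^+ m) ^+ r * alpha r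
   / qpoch (A * p) p (r + r)
   * (qpoch (e * p ^+ r) p (m - r)
      / qpoch (rho * p ^+ r * (e * p ^+ r)) p (m - r))).
  rewrite -h mulr_sumr subSn //; apply: eq_bigr => i _.
  rewrite /f -addnA [(i + r)%N]addnC addnA !qpochD [_ ^+ (r + i)]exprD.
  have -> : (p ^+ m)^-1 * p ^+ r = (p ^+ (m - r))^-1.
    by rewrite -{1}(subnK r_le) exprD invfM mulfVK // expf_neq0.
  have -> : e * p ^+ r * p ^+ (m - r) = e * p ^+ m.
    by rewrite -mulrA -exprD subnKC.
  have -> : A * p * p ^+ (r + r) = rho * p ^+ r * (e * p ^+ r).
    by rewrite -[RHS]mulr1 -(expr0 p) -hA' addn0.
  by rewrite !invfM; ring.
have hE : qpoch e p m = qpoch e p r * qpoch (e * p ^+ r) p (m - r).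
  by rewrite -qpochD subnKC.
have hEr : qpoch e p r != 0.
  by apply: qpoch_neq0 => i i_lt; apply: he; apply: leq_trans r_le.
(* Both sides are [qpoch (A * p) p (m + r)], split at [m] and at [r + r]. *)
have hB : qpoch (A * p) p m * qpoch (A * p * p ^+ m) p r
   = qpoch (A * p) p (r + r) * qpoch (rho * p ^+ r * (e * p ^+ r)) p (m - r).
  rewrite -[rho * _ * _]mulr1 -(expr0 p) -hA' addn0 -!qpochD.
  by congr qpoch; lia.
have hm := @qpoch_neq0 F (A * p) p m (fun i _ => hA i).
have hmr : qpoch (A * p * p ^+ m) p r != 0.
  by apply: qpoch_neq0 => i _; rewrite -mulrA -exprD.
have := mulf_neq0 hm hmr; rewrite {1}hB mulf_eq0 negb_or => /andP[h1 h2].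
rewrite hE.
transitivity (qpoch (p ^+ m)^-1 p r * qpoch rho p r * (e * p ^+ m) ^+ r * alpha r
   * qpoch (e * p ^+ r) p (m - r)
   / (qpoch (A * p) p m * qpoch (A * p * p ^+ m) p r)).
  by rewrite hB !invfM; ring.
rewrite !invfM; move: hEr; move: (qpoch e p r) => E hEr.
transitivity (E / E * (qpoch (p ^+ m)^-1 p r * qpoch rho p r * (e * p ^+ m) ^+ r * alpha r
   * qpoch (e * p ^+ r) p (m - r)
   * ((qpoch (A * p) p m)^-1 * (qpoch (A * p * p ^+ m) p r)^-1))).
  by rewrite divff // mul1r.
by ring.
Qed.

(** * The exact perturbed identity *)

Lemma qintE (F : fieldType) (q : F) (m : nat) : (1 - q) * qint q m = 1 - q ^+ m.
Proof.
rewrite /qint -{2}(expr1n F m) subrXX; congr (_ * _).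
by apply: eq_bigr => i _; rewrite expr1n mul1r.
Qed.

(** Read backwards, the factors on the left are [1 - q^-(4j-2)] for [j = 1, ..., m]. Each is
    [- q^-(4j-2)] times [1 - q^(4j-2)], and the numbers [4j-2] add up to [2 * m ^ 2]. *)
Lemma qpoch_reverse (F : fieldType) (q : F) (m : nat) : q != 0 ->
  qpoch (q ^+ 2 / q ^+ (4 * m)) (q ^+ 4) m * q ^+ (2 * m ^ 2)
  = (-1) ^+ m * qpoch (q ^+ 2) (q ^+ 4) m.
Proof.
move=> q0; elim: m => [|m IHm]; first by rewrite !qpoch0 muln0 !expr0.
rewrite qpochS qpochSr [(-1) ^+ m.+1]exprS.
have -> : q ^+ 2 / q ^+ (4 * m.+1) * q ^+ 4 = q ^+ 2 / q ^+ (4 * m).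
  by rewrite mulnS exprD; field; rewrite q0 expf_neq0.
have -> : q ^+ (2 * m.+1 ^ 2) = q ^+ (2 * m ^ 2) * (q ^+ (4 * m) * q ^+ 2).
  by rewrite -!exprD; congr (_ ^+ _); lia.
transitivity ((1 - q ^+ 2 / q ^+ (4 * m.+1)) * (q ^+ (4 * m) * q ^+ 2)
  * (qpoch (q ^+ 2 / q ^+ (4 * m)) (q ^+ 4) m * q ^+ (2 * m ^ 2))); first by ring.
rewrite IHm -exprM mulnS exprD.
have := expf_neq0 (4 * m) q0.
move: (q ^+ (4 * m)) (_ ^+ m) (qpoch _ _ _) => x s P x0.
by field; rewrite q0 x0.
Qed.

Section ExactIdentity.
Variables (F : fieldType) (q : F).
Hypotheses (q0 : q != 0) (q_generic : forall m, (0 < m)%N -> 1 - q ^+ m != 0).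

Let qD1 : 1 + q != 0.
Proof.
have := @q_generic 2 isT; have -> : 1 - q ^+ 2 = (1 - q) * (1 + q) by ring.
by rewrite mulf_eq0 negb_or => /andP[].
Qed.

Let q1 : 1 - q != 0. Proof. by rewrite -[q]expr1; exact: q_generic. Qed.

(** The first member of the Bailey pair above with base [q ^+ 4] and [c = d = q], hence relative to
    [q ^+ 2]. *)
Let alpha r := (1 - q * q * (q ^+ 4) ^+ r ^+ 2) * qpoch q (q ^+ 4) r * (-1) ^+ r
      * (q ^+ 4) ^+ 'C(r, 2) * q ^+ r / qpoch (q * q ^+ 4) (q ^+ 4) r.

(** The quotient of the symbols at [q] and [q ^+ 5] collapses to [(1 - q) / (1 - q ^+ (4 * r + 1))],
    which leaves [1 + q ^+ (4 * r + 1)] out of [1 - q ^+ (8 * r + 2)]. The power [q ^+ (2 * r)]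
    comes from the Bailey lemma, where [e * p ^+ m] will be [q ^+ 2]. *)
Let alphaE r : q ^+ (2 * r) * alpha r =
  (1 - q ^+ 2) * ((-1) ^+ r * ((1 + q ^+ (4 * r + 1)) / (1 + q)) * q ^+ (2 * r ^ 2 + r)).
Proof.
rewrite /alpha.
have E : qpoch q (q ^+ 4) r * (1 - q * (q ^+ 4) ^+ r)
       = (1 - q) * qpoch (q * q ^+ 4) (q ^+ 4) r by rewrite -qpochSr qpochS.
have -> : q ^+ (2 * r ^ 2 + r) = q ^+ (2 * r) * (q ^+ 4) ^+ 'C(r, 2) * q ^+ r.
  rewrite -exprM -!exprD; congr (_ ^+ _).
  by have := mul_bin_left r 1; rewrite bin1; case: (r) => // k; nia.
have hP : qpoch (q * q ^+ 4) (q ^+ 4) r != 0.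
  by apply: qpoch_neq0 => i _; rewrite -exprM -exprS -exprD q_generic.
rewrite [q ^+ (4 * r + 1)]exprD -[(q ^+ 4) ^+ r]exprM expr1 in E *.
have hx : 1 - q * q ^+ (4 * r) != 0 by rewrite -exprS q_generic.
move: (q ^+ (4 * r)) hx E => x hx.
move: (qpoch q _ r) (qpoch (q * _) _ r) hP => P Q hQ E.
have -> : P = (1 - q) * Q / (1 - q * x) by rewrite -E mulfK.
move: (q ^+ (2 * r)) ((-1) ^+ r) ((q ^+ 4) ^+ _) (q ^+ r) => a s b d.
by field; rewrite hx hQ qD1.
Qed.

(** At [d = q] the factor [(1 - d) / (1 - d * p ^+ j)] of the Bailey pair becomes
    [1 / qint q (4 * j + 1)]; this is the source of the q-integers [[4k+1]]. *)
Let beta_sum j :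
  \sum_(r < j.+1) alpha r / (qpoch (q ^+ 4) (q ^+ 4) (j - r)
                             * qpoch (q ^+ 2 * q ^+ 4) (q ^+ 4) (j + r))
  = (1 - q ^+ 2) / (qint q (4 * j + 1) * qpoch (q ^+ 2) (q ^+ 4) j
                    * qpoch (q ^+ 4) (q ^+ 4) j).
Proof.
rewrite expr2 bailey_pair ?expf_neq0 // => [|i|i|i];
  try by rewrite -?exprM -?expr2 -?exprD -?exprS -?exprD q_generic.
have := qintE _ q (4 * j + 1); rewrite addn1 exprS exprM => hI.
have E : qpoch (q * q) (q ^+ 4) j * (1 - q * q * (q ^+ 4) ^+ j)
       = (1 - q * q) * qpoch (q * q * q ^+ 4) (q ^+ 4) j by rewrite -qpochSr qpochS.
have h2 : 1 - q * q != 0 by rewrite -expr2 q_generic.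
have hx : 1 - q * (q ^+ 4) ^+ j != 0 by rewrite -exprM -exprS q_generic.
have hP : qpoch (q * q * q ^+ 4) (q ^+ 4) j != 0.
  by apply: qpoch_neq0 => i _; rewrite -exprM -expr2 -!exprD q_generic.
have hQ : qpoch (q * q) (q ^+ 4) j != 0.
  by apply: qpoch_neq0 => i _; rewrite -exprM -expr2 -!exprD q_generic.
have hR : qpoch (q ^+ 4) (q ^+ 4) j != 0.
  by apply: qpoch_neq0 => i _; rewrite -exprM -!exprD q_generic.
have hx2 : 1 - q * q * (q ^+ 4) ^+ j != 0.
  by rewrite -exprM -expr2 -exprD q_generic.
have -> : qint q (4 * j).+1 = (1 - q * (q ^+ 4) ^+ j) / (1 - q) by rewrite -hI mulrC mulKf.
have {E} -> : qpoch (q * q * q ^+ 4) (q ^+ 4) j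
   = qpoch (q * q) (q ^+ 4) j * (1 - q * q * (q ^+ 4) ^+ j) / (1 - q * q).
  by apply: (mulfI h2); rewrite -E [RHS]mulrC divfK.
move: (qpoch _ _ _) (qpoch _ _ _) hQ hR (_ ^+ j) hx hx2 => Q R hQ hR x hx hx2.
by field; rewrite hx hx2 hQ hR h2 q1.
Qed.

(** The Bailey lemma with [A = q ^+ 2], [rho = q ^+ 2 * w] and [e = q ^+ 4 / w]. The choice of [w]
    makes [q ^+ 2 / w] the inverse of [(q ^+ 4) ^+ m], and it lets the prefactor be evaluated by
    reversal. *)
Lemma perturbed_identity m (w := q ^+ (2 * (2 * m + 1))) :
  \sum_(k < m.+1) (-1) ^+ k * ((1 + q ^+ (4 * k + 1)) / (1 + q)) * q ^+ (2 * k ^ 2 + k)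
     * (qpoch (q ^+ 2 / w) (q ^+ 4) k * qpoch (q ^+ 2 * w) (q ^+ 4) k
        / (qpoch (q ^+ 4 / w) (q ^+ 4) k * qpoch (q ^+ 4 * w) (q ^+ 4) k))
  = (-1) ^+ m * qint (q ^+ 2) (2 * m + 1) * q ^+ (2 * m ^ 2)
    * \sum_(k < m.+1) qpoch (q ^+ 2 / w) (q ^+ 4) k * qpoch (q ^+ 2 * w) (q ^+ 4) k
       / (qint q (4 * k + 1) * qpoch (q ^+ 2) (q ^+ 4) k * qpoch (q ^+ 4) (q ^+ 4) k)
       * q ^+ (2 * k).
Proof.
have X0 := expf_neq0 (4 * m) q0.
have wE : w = q ^+ 2 * q ^+ (4 * m) by rewrite -exprD; congr (_ ^+ _); lia.
set X := q ^+ (4 * m) in X0 wE.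
have XE : X = (q ^+ 4) ^+ m by rewrite -exprM.
have := @bailey_lemma F (q ^+ 4) (q ^+ 2) (q ^+ 2 * w) (q ^+ 4 / w) alpha m.
rewrite -XE.
have -> : q ^+ 4 / w * X = q ^+ 2 by rewrite wE; field; rewrite q0 X0.
have -> : q ^+ 2 * q ^+ 4 * X = q ^+ 4 * w by rewrite wE; ring.
have -> : X^-1 = q ^+ 2 / w by rewrite wE; field; rewrite q0 X0.
have h2 : 1 - q ^+ 2 != 0 by rewrite q_generic.
(* The power of [q] subtracted here has exponent [-(4 * (m - i.+1) + 2)], which is never zero. *)
have he i : (i < m)%N -> 1 - q ^+ 4 / w * (q ^+ 4) ^+ i != 0.
  move=> lt_im; have -> : 1 - q ^+ 4 / w * (q ^+ 4) ^+ i =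
     - (1 - q ^+ (4 * (m - i.+1) + 2)) / q ^+ (4 * (m - i.+1) + 2).
    have -> : w = q ^+ (4 * (m - i.+1) + 2) * (q ^+ 4) ^+ i * q ^+ 4.
      by rewrite wE -exprM -!exprD; congr (_ ^+ _); lia.
    have := expf_neq0 i (expf_neq0 4 q0); have := expf_neq0 (4 * (m - i.+1) + 2) q0.
    move: (q ^+ (_ + 2)) ((q ^+ 4) ^+ i) => a b a0 b0.
    by field; rewrite a0 b0 q0.
  by rewrite mulf_neq0 ?oppr_eq0 ?invr_eq0 ?expf_neq0 // q_generic // addn2.
rewrite expf_neq0 // => /(_ isT).
have -> : q ^+ 2 * w * (q ^+ 4 / w) = q ^+ 2 * q ^+ 4.
  by rewrite wE; field; rewrite q0 X0.
have hp i : 1 - q ^+ 4 * (q ^+ 4) ^+ i != 0 by rewrite -exprM -exprD q_generic.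
have hA6 i : 1 - q ^+ 2 * q ^+ 4 * (q ^+ 4) ^+ i != 0.
  by rewrite -exprM -!exprD q_generic.
move=> /(_ erefl hp hA6 he) H.
(* Passing from [q ^+ 6] to [q ^+ 2] exchanges the two end factors, whose quotient is [[2m+1]] in
   base [q ^+ 2]. *)
have hA : qpoch (q ^+ 2 * q ^+ 4) (q ^+ 4) m = qpoch (q ^+ 2) (q ^+ 4) m * qint (q ^+ 2) (2 * m + 1).
  apply: (mulfI h2); rewrite -qpochS qpochSr [RHS]mulrCA qintE -exprM -exprD -exprM.
  by congr (_ * (1 - _ ^+ _)); lia.
have hw : q ^+ 4 / w = q ^+ 2 / X by rewrite wE; field; rewrite q0 X0.
have hR := qpoch_reverse _ _ m q0.
rewrite -/X -hw in hR.
have hP : qpoch (q ^+ 2) (q ^+ 4) m != 0.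
  by apply: qpoch_neq0 => i _; rewrite -exprM -!exprD q_generic.
have hI : qint (q ^+ 2) (2 * m + 1) != 0.
  have := qintE _ (q ^+ 2) (2 * m + 1); have : 1 - (q ^+ 2) ^+ (2 * m + 1) != 0.
    by rewrite -exprM q_generic // addn1.
  by move=> h hE; move: h; rewrite -hE mulf_eq0 negb_or => /andP[].
have qe0 := expf_neq0 (2 * m ^ 2) q0.
have hQ : qpoch (q ^+ 4 / w) (q ^+ 4) m
  = (-1) ^+ m * qpoch (q ^+ 2) (q ^+ 4) m / q ^+ (2 * m ^ 2).
  by rewrite -hR mulfK.
rewrite hQ hA in H.
have Hl : \sum_(k < m.+1) qpoch (q ^+ 2 / w) (q ^+ 4) k * qpoch (q ^+ 2 * w) (q ^+ 4) k
       / (qint q (4 * k + 1) * qpoch (q ^+ 2) (q ^+ 4) k * qpoch (q ^+ 4) (q ^+ 4) k)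
       * q ^+ (2 * k) = (1 - q ^+ 2)^-1 * ((-1) ^+ m * qpoch (q ^+ 2) (q ^+ 4) m / q ^+ (2 * m ^ 2) /
    (qpoch (q ^+ 2) (q ^+ 4) m * qint (q ^+ 2) (2 * m + 1)) * \sum_(r < m.+1)
      qpoch (q ^+ 2 / w) (q ^+ 4) r * qpoch (q ^+ 2 * w) (q ^+ 4) r * q ^+ 2 ^+ r /
      (qpoch (q ^+ 4 / w) (q ^+ 4) r * qpoch (q ^+ 4 * w) (q ^+ 4) r) * alpha r).
  rewrite -H mulr_sumr; apply: eq_bigr => j _; rewrite beta_sum exprM.
  by apply: (mulfI h2); rewrite [RHS]mulrA divff // mul1r; ring.
rewrite Hl.
have -> : \sum_(r < m.+1)
      qpoch (q ^+ 2 / w) (q ^+ 4) r * qpoch (q ^+ 2 * w) (q ^+ 4) r * q ^+ 2 ^+ r /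
      (qpoch (q ^+ 4 / w) (q ^+ 4) r * qpoch (q ^+ 4 * w) (q ^+ 4) r) * alpha r
  = (1 - q ^+ 2) * \sum_(k < m.+1) (-1) ^+ k * ((1 + q ^+ (4 * k + 1)) / (1 + q)) * q ^+ (2 * k ^ 2 + k)
     * (qpoch (q ^+ 2 / w) (q ^+ 4) k * qpoch (q ^+ 2 * w) (q ^+ 4) k
        / (qpoch (q ^+ 4 / w) (q ^+ 4) k * qpoch (q ^+ 4 * w) (q ^+ 4) k)).
  rewrite mulr_sumr; apply: eq_bigr => r _; rewrite [RHS]mulrA -alphaE exprM; ring.
have sqs : (-1) ^+ m * (-1) ^+ m = 1 :> F by rewrite -exprMn mulrNN mulr1 expr1n.
move: (\sum_(_ < _) _) (qpoch (q ^+ 2) _ m) (qint _ _) (q ^+ (2 * _)) hP hI qe0 => S P I e hP hI e0.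
move: ((-1) ^+ m) sqs => s sqs.
transitivity (s * s * S); first by rewrite sqs mul1r.
by field; rewrite hP hI e0 h2.
Qed.

End ExactIdentity.

(** * Cyclotomic polynomials *)

Lemma size_Phi n : size (Phi n) = (totient n).+1.
Proof. by rewrite size_map_inj_poly ?size_Cyclotomic //; exact: intr_inj. Qed.

Lemma size_PhiN n : size (PhiN n) = (totient n).+1.
Proof. by rewrite size_comp_poly2 ?size_Phi // size_polyN size_polyX. Qed.

(** The roots of [Phi n] in [algC] are exactly the primitive [n]-th roots of unity, so coprimality
    can be tested there. *)
Lemma coprime_Phi (n : nat) (p : {poly rat}) : (0 < n)%N ->
  (forall z : algC, n.-primitive_root z -> (map_poly ratr p).[z] != 0) ->
  coprimep p (Phi n).
Proof.
move=> n0 hp; have [z pz] := C_prim_root_exists n0.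
rewrite coprimep_sym -(coprimep_map (ratr : {rmorphism rat -> algC})).
apply: Pdiv.ClosedField.root_coprimep => x.
rewrite -map_poly_comp (eq_map_poly (g := intr)); last by move=> i /=; rewrite ratr_int.
by rewrite (Cintr_Cyclotomic pz) root_cyclotomic //; exact: hp.
Qed.

Lemma comp_polyNXK (p : {poly rat}) : (p \Po - 'X) \Po - 'X = p.
Proof. by rewrite -comp_polyA raddfN /= comp_polyX opprK comp_polyXr. Qed.

(** Substituting [- 'X] is an involution that preserves coprimality, which moves questions about
    [PhiN n] to [Phi n]. *)
Lemma coprime_PhiN (n : nat) (p : {poly rat}) :
  coprimep (p \Po - 'X) (Phi n) -> coprimep p (PhiN n).
Proof. by move=> /(coprimep_comp_poly (- 'X)); rewrite comp_polyNXK. Qed.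

Lemma dvdp_Phi n : (0 < n)%N -> Phi n %| 'X^n - 1.
Proof.
move=> n0; have <- : map_poly intr ('X^n - 1 : {poly int}) = 'X^n - 1 :> {poly rat}.
  by rewrite rmorphB /= map_polyXn rmorph1.
rewrite -prod_Cyclotomic // (big_rem n) /= -?dvdn_divisors //.
by rewrite rmorphM dvdp_mulr.
Qed.

Lemma dvdp_PhiN n : odd n -> PhiN n %| 1 + 'X^n.
Proof.
move=> n_odd; have n0 := odd_gt0 n_odd.
have := dvdp_comp_poly (- 'X) (dvdp_Phi _ n0).
rewrite comp_polyB comp_Xn_poly -polyC1 comp_polyC exprNn -signr_odd n_odd expr1.
by rewrite mulN1r -opprD dvdpNr addrC.
Qed.

Lemma dvdp_Phi_double n : odd n -> Phi n %| 1 - 'X^(2 * n).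
Proof.
move=> n_odd; have -> : 1 - 'X^(2 * n) = - (('X^n - 1) * ('X^n + 1)) :> {poly rat}.
  by rewrite mulnC exprM; ring.
by rewrite dvdpNr dvdp_mulr // dvdp_Phi // odd_gt0.
Qed.

Lemma dvdp_PhiN_double n : odd n -> PhiN n %| 1 - 'X^(2 * n).
Proof.
move=> n_odd; have -> : 1 - 'X^(2 * n) = (1 + 'X^n) * (1 - 'X^n) :> {poly rat}.
  by rewrite mulnC exprM; ring.
by rewrite dvdp_mulr // dvdp_PhiN.
Qed.

(** The two polynomials divide ['X^n - 1] and [1 + 'X^n], which differ by the nonzero constant 2. *)
Lemma coprime_Phi_PhiN n : odd n -> coprimep (PhiN n) (Phi n).
Proof.
move=> n_odd; apply: coprimep_dvdr (dvdp_PhiN _ n_odd) _.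
apply: coprimep_dvdl (dvdp_Phi _ (odd_gt0 n_odd)) _.
have -> : 1 + 'X^n = 1 * ('X^n - 1) + 2%:R :> {poly rat} by ring.
rewrite coprimep_sym coprimep_addl_mul -polyC_natr -alg_polyC.
by rewrite coprimepZr ?coprimep1.
Qed.

Section Coprime.
Variables (n : nat).
Hypotheses (n_gt1 : (1 < n)%N) (n_odd : odd n).

Let n_gt0 : (0 < n)%N. Proof. exact: ltnW. Qed.

Let prim_double (z : algC) m : n.-primitive_root z -> (z ^+ (2 * m) == 1) = (n %| m)%N.
Proof.
move=> pz; rewrite -(prim_order_dvd pz) Gauss_dvdr //.
by rewrite coprimen2.
Qed.

Lemma coprime_Xn_Phi m : ~~ (n %| m)%N -> coprimep (1 - 'X^(2 * m)) (Phi n).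
Proof.
move=> nm; apply: coprime_Phi => // z pz.
rewrite rmorphB rmorph1 /= map_polyXn hornerD hornerN hornerXn hornerC.
by rewrite subr_eq0 eq_sym prim_double.
Qed.

Lemma coprime_Xn_PhiN m : ~~ (n %| m)%N -> coprimep (1 - 'X^(2 * m)) (PhiN n).
Proof.
move=> nm; apply: coprime_PhiN.
rewrite comp_polyB comp_Xn_poly -polyC1 comp_polyC exprM sqrrN -exprM.
exact: coprime_Xn_Phi.
Qed.

(** Here [s] is 1 or -1. Both signs serve, since substituting [- 'X] exchanges [1 + 'X] and
    [1 - 'X]; each of these divides [1 - 'X^2]. *)
Let coprime_1pX (s : rat) : s ^+ 2 = 1 -> coprimep (1 + s *: 'X) (Phi n).
Proof.
move=> s2; apply: (@coprimep_dvdr _ (1 - 'X^(2 * 1))); last first.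
  by apply: coprime_Xn_Phi; rewrite dvdn1 neq_ltn n_gt1 orbT.
apply/dvdpP; exists (1 - s *: 'X).
rewrite -['X^_]scale1r -s2 expr2 -scalerA -!mul_polyC muln1 expr2; ring.
Qed.

Lemma coprime_X1_Phi : coprimep (1 + 'X) (Phi n).
Proof. by rewrite -['X]scale1r coprime_1pX ?expr1n. Qed.

Lemma coprime_X1_PhiN : coprimep (1 + 'X) (PhiN n).
Proof.
apply: coprime_PhiN; rewrite comp_polyD comp_polyX -polyC1 comp_polyC -scaleN1r.
by rewrite coprime_1pX ?sqrrN ?expr1n.
Qed.

Lemma coprime_X_Phi : coprimep 'X (Phi n).
Proof.
apply: coprime_Phi => // z pz; rewrite map_polyX hornerX.
apply/eqP => z0; have /eqP := prim_expr_order pz.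
by rewrite z0 expr0n gtn_eqF // eq_sym oner_eq0.
Qed.

Lemma coprime_X_PhiN : coprimep 'X (PhiN n).
Proof.
apply: coprime_PhiN; rewrite comp_polyX -scaleN1r coprimepZl ?coprime_X_Phi //.
Qed.

End Coprime.

(** * Double sums over a triangle *)

Lemma sum_triangle_sym (V : nmodType) (f : nat -> nat -> V) (m : nat) :
  \sum_(r < m) \sum_(i < m - r) f r i = \sum_(r < m) \sum_(i < m - r) f i r.
Proof.
rewrite -(sum_triangle _ f) -(sum_triangle _ (fun r i => f i r)).
apply: eq_bigr => j _.
rewrite (reindex_inj rev_ord_inj) /=; apply: eq_bigr => r _.
by rewrite subSS subKn // -ltnS.
Qed.

(** The pairs with both indices at most [m] give the square. As the indices add up to at most
    [2 * m], at most one of them exceeds [m]; by symmetry the two cases contribute equally. *)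
Lemma double_sum_split (R : comPzRingType) (c : nat -> R) (m : nat) :
  \sum_(k < 2 * m + 1) \sum_(j < k.+1) c j * c (k - j)%N
  = (\sum_(k < m.+1) c k) ^+ 2
    + (\sum_(i < m) c (m.+1 + i)%N * \sum_(j < m - i) c j) *+ 2.
Proof.
rewrite (sum_triangle _ (fun i j => c i * c j)).
rewrite (_ : 2 * m + 1 = m.+1 + m)%N; last by lia.
rewrite big_split_ord /= mulr2n addrA; congr (_ + _); last first.
  apply: eq_bigr => i _; rewrite mulr_sumr subnDl.
  by [].
(* Row [r <= m] has [m.+1 + (m - r)] entries: a full row of the square, then a tail of length
   [m - r]. *)
transitivity (\sum_(r < m.+1) (c r * (\sum_(k < m.+1) c k)
                               + \sum_(i < m - r) c r * c (m.+1 + i)%N)).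
  apply: eq_bigr => r _; rewrite -addnBA; last by rewrite -ltnS.
  by rewrite big_split_ord /= mulr_sumr.
rewrite big_split /= -mulr_suml expr2; congr (_ + _).
rewrite big_ord_recr /= subnn big_ord0 addr0.
rewrite (sum_triangle_sym _ (fun r i => c r * c (m.+1 + i)%N)).
by apply: eq_bigr => r _; rewrite mulr_sumr; apply: eq_bigr => i _; rewrite mulrC.
Qed.

(** * Congruences between rational functions *)

Section Adic.
Variables (F : fieldType) (iota : {rmorphism {poly rat} -> F}).
Hypothesis iota_inj : injective iota.

(* [x] lies in the [k]-th power of the ideal generated by [P] in the
   localization of [Q[X]] at the polynomials coprime to [P]. *)
Definition adic (P : {poly rat}) (k : nat) (x : F) : Prop :=
  exists u v : {poly rat},
    [/\ coprimep v P, v != 0 & x = iota (P ^+ k * u) / iota v].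

(** The units of the same localization. Nonvanishing is asked separately because coprimality to a
    constant [P] does not exclude zero. *)
Definition adic_unit (P : {poly rat}) (x : F) : Prop :=
  exists u v : {poly rat},
    [/\ coprimep u P, coprimep v P, u != 0, v != 0 & x = iota u / iota v].

Lemma iota_neq0 (u : {poly rat}) : u != 0 -> iota u != 0.
Proof. by rewrite raddf_eq0. Qed.

Lemma adic_reduced (P Q : {poly rat}) (k l : nat) (x : F) :
  coprimep P Q -> adic P k x -> adic Q l x ->
  exists u v : {poly rat}, [/\ v != 0, coprimep u v, x = iota u / iota v,
    P ^+ k * Q ^+ l %| u & coprimep v (P ^+ k * Q ^+ l)].
Proof.
move=> cPQ hP hQ.
have [u [v [v0 cuv xE]]] : exists u v : {poly rat},
    [/\ v != 0, coprimep u v & x = iota u / iota v].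
  have [u [v [_ v0 ->]]] := hP; set w := P ^+ k * u.
  have d0 : gcdp w v != 0 by rewrite gcdp_eq0 negb_and v0 orbT.
  exists (w %/ gcdp w v), (v %/ gcdp w v).
  have v'0 : v %/ gcdp w v != 0 by rewrite dvdp_div_eq0 ?dvdp_gcdr.
  split; rewrite ?coprimep_div_gcd ?v0 ?orbT //.
  rewrite -{1}(divpK (dvdp_gcdl w v)) -{3}(divpK (dvdp_gcdr w v)) !rmorphM.
  by field; rewrite !iota_neq0.
(* Cross-multiplying the reduced form with any other presentation gives [u * b = R ^+ m * a * v].
   Since [b] is coprime to [R], [R ^+ m] divides [u]; since [u] is coprime to [v], [v] divides [b]
   and inherits its coprimality to [R]. *)
have key (R : {poly rat}) m : adic R m x -> R ^+ m %| u /\ coprimep v R.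
  case=> a [b [cb b0 E]].
  have {}E : u * b = R ^+ m * a * v.
    apply: iota_inj; rewrite !rmorphM.
    have := E; rewrite xE => E'.
    apply: (mulIf (iota_neq0 _ v0)); apply: (mulIf (iota_neq0 _ b0)).
    transitivity (iota u / iota v * (iota b * iota b * iota v * iota v)).
      by field; rewrite iota_neq0.
    rewrite E' !rmorphM; field; by rewrite iota_neq0.
  split.
    rewrite -(@Gauss_dvdpl _ u b) ?E -?mulrA ?dvdp_mulr //.
    by rewrite coprimep_expl // coprimep_sym.
  apply: coprimep_dvdr cb; rewrite -(@Gauss_dvdpr _ b u v) ?E ?dvdp_mull //.
  by rewrite coprimep_sym.
have [dP cP] := key _ _ hP; have [dQ cQ] := key _ _ hQ.
exists u, v; split=> //.
  by rewrite Gauss_dvdp ?dP // coprimep_expl // coprimep_expr.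
by rewrite coprimepMr !coprimep_expr.
Qed.

Section Fixed.
Variable P : {poly rat}.

Lemma adic0 k : adic P k 0.
Proof.
exists 0, 1; split; rewrite ?coprime1p ?oner_neq0 //.
by rewrite mulr0 rmorph0 mul0r.
Qed.

Lemma adicN k x : adic P k x -> adic P k (- x).
Proof.
case=> u [v [cv v0 ->]]; exists (- u), v; split=> //.
by rewrite mulrN rmorphN mulNr.
Qed.

Lemma adicD k x y : adic P k x -> adic P k y -> adic P k (x + y).
Proof.
case=> u [v [cv v0 ->]] [u' [v' [cv' v0' ->]]].
exists (u * v' + u' * v), (v * v'); split; rewrite ?coprimepMl ?cv ?mulf_neq0 //.
rewrite !(rmorphM, rmorphD).
by field; rewrite !iota_neq0.
Qed.

Lemma adicB k x y : adic P k x -> adic P k y -> adic P k (x - y).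
Proof. by move=> hx hy; apply: adicD => //; apply: adicN. Qed.

Lemma adicM k l x y : adic P k x -> adic P l y -> adic P (k + l) (x * y).
Proof.
case=> u [v [cv v0 ->]] [u' [v' [cv' v0' ->]]].
exists (u * u'), (v * v'); split; rewrite ?coprimepMl ?cv ?mulf_neq0 //.
rewrite exprD !(rmorphM, rmorphD).
by field; rewrite !iota_neq0.
Qed.

Lemma adicMl k x y : adic P 0 x -> adic P k y -> adic P k (x * y).
Proof. exact: adicM. Qed.

Lemma adicMr k x y : adic P k x -> adic P 0 y -> adic P k (x * y).
Proof. by rewrite -{2}[k]addn0; exact: adicM. Qed.

Lemma adicX k m x : adic P k x -> adic P (k * m) (x ^+ m).
Proof.
move=> hx; elim: m => [|m IHm]; last by rewrite mulnS exprS; apply: adicM.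
rewrite muln0 expr0; exists 1, 1.
by rewrite coprime1p oner_neq0 expr0 mulr1 rmorph1 divr1.
Qed.

Lemma adic_sum k (I : finType) (f : I -> F) :
  (forall i, adic P k (f i)) -> adic P k (\sum_i f i).
Proof.
by move=> h; apply: big_ind => [|x y|i _]; [exact: adic0|exact: adicD|].
Qed.

Lemma adicW k l x : (l <= k)%N -> adic P k x -> adic P l x.
Proof.
move=> le_lk [u [v [cv v0 ->]]]; exists (P ^+ (k - l) * u), v; split=> //.
by rewrite mulrA -exprD subnKC.
Qed.

Lemma adic_iota k u : P ^+ k %| u -> adic P k (iota u).
Proof.
move=> /divpK <-; exists (u %/ P ^+ k), 1.
by rewrite coprime1p oner_neq0 rmorph1 divr1 mulrC.
Qed.

Lemma adic_unit_neq0 x : adic_unit P x -> x != 0.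
Proof.
case=> u [v [_ _ u0 v0 ->]]; by rewrite mulf_neq0 ?invr_eq0 ?iota_neq0.
Qed.

Lemma adic_unit_adic x : adic_unit P x -> adic P 0 x.
Proof. by case=> u [v [_ cv _ v0 ->]]; exists u, v; rewrite mul1r. Qed.

Lemma adic_unitV x : adic_unit P x -> adic_unit P x^-1.
Proof.
by case=> u [v [cu cv u0 v0 ->]]; exists v, u; split=> //; rewrite invf_div.
Qed.

Lemma adic_unitM x y : adic_unit P x -> adic_unit P y -> adic_unit P (x * y).
Proof.
case=> u [v [cu cv u0 v0 ->]] [u' [v' [cu' cv' u0' v0' ->]]].
exists (u * u'), (v * v'); split; rewrite ?coprimepMl ?cv ?cu ?mulf_neq0 //.
by rewrite !rmorphM mulf_div.
Qed.

Lemma adic_unit1 : adic_unit P 1.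
Proof.
by exists 1, 1; rewrite coprime1p oner_neq0 rmorph1 divr1.
Qed.

Lemma adic_unitX m x : adic_unit P x -> adic_unit P (x ^+ m).
Proof.
move=> hx; elim: m => [|m IHm]; first exact: adic_unit1.
by rewrite exprS; apply: adic_unitM.
Qed.

Lemma adic_unit_prod (m : nat) (f : nat -> F) :
  (forall i, (i < m)%N -> adic_unit P (f i)) -> adic_unit P (\prod_(i < m) f i).
Proof.
move=> h; apply: big_ind => [|x y|i _]; [exact: adic_unit1|exact: adic_unitM|].
exact: h.
Qed.

Lemma adic_unit_iota u : size P != 1%N -> coprimep u P -> adic_unit P (iota u).
Proof.
move=> sP cu; exists u, 1; split; rewrite ?coprime1p ?oner_neq0 ?rmorph1 ?divr1 //.
by apply: contraNneq sP => u0; move: cu; rewrite u0 coprime0p -size_poly_eq1.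
Qed.

(** Over the common denominator the numerator of [y] is that of [x] minus a multiple of [P], so it
    stays coprime to [P]. *)
Lemma adic_unit_eqmod x y :
  size P != 1%N -> adic_unit P x -> adic P 1 (x - y) -> adic_unit P y.
Proof.
move=> sP [u [v [cu cv u0 v0 hx]]] [a [b [cb b0 hxy]]].
have yE : y = x - (x - y) by ring.
have cN : coprimep (u * b - P * a * v) P.
  rewrite coprimep_sym -mulrA -mulrN [P * _]mulrC addrC coprimep_addl_mul coprimep_sym.
  by rewrite coprimepMl cu.
exists (u * b - P * a * v), (v * b); split; rewrite ?coprimepMl ?cv ?mulf_neq0 //.
  by apply: contraNneq sP => N0; move: cN; rewrite N0 coprime0p -size_poly_eq1.
rewrite yE hxy hx expr1 rmorphB !rmorphM.
by field; rewrite !iota_neq0.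
Qed.

Lemma eqmodM k x x' y y' : adic P 0 x -> adic P 0 y' ->
  adic P k (x - x') -> adic P k (y - y') -> adic P k (x * y - x' * y').
Proof.
move=> hx hy' hxx hyy; have -> : x * y - x' * y' = x * (y - y') + (x - x') * y' by ring.
by apply: adicD; [apply: adicMl | apply: adicMr].
Qed.

Lemma eqmodV k x y : adic_unit P x -> adic_unit P y ->
  adic P k (x - y) -> adic P k (x^-1 - y^-1).
Proof.
move=> hx hy hxy.
have -> : x^-1 - y^-1 = - (x^-1 * ((x - y) * y^-1)).
  by field; rewrite !adic_unit_neq0.
by apply/adicN/adicMl; last apply: adicMr => //; apply/adic_unit_adic/adic_unitV.
Qed.

Lemma eqmod_prod k m (f g : nat -> F) :
  (forall i, (i < m)%N -> adic P 0 (f i)) -> (forall i, (i < m)%N -> adic P 0 (g i)) ->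
  (forall i, (i < m)%N -> adic P k (f i - g i)) ->
  adic P k (\prod_(i < m) f i - \prod_(i < m) g i).
Proof.
elim: m => [|m IHm] hf hg hfg; first by rewrite !big_ord0 subrr; apply: adic0.
have hf' : adic P 0 (\prod_(i < m) f i).
  apply: big_ind => [|x y|i _]; first exact/adic_unit_adic/adic_unit1.
    exact: adicMl.
  by apply: hf; rewrite ltnS ltnW.
rewrite !big_ord_recr /=; apply: eqmodM => //; [exact: hg| |exact: hfg].
by apply: IHm => i lt_im; [apply: hf|apply: hg|apply: hfg]; rewrite ltnS ltnW.
Qed.

(** * Truncated sums modulo powers of a divisor of [1 - q^(2n)] *)

Section Congruences.
Variable N : nat.
Hypothesis N_gt0 : (0 < N)%N.
Let q := iota 'X.
Let n := (2 * N + 1)%N.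
Let w := q ^+ (2 * n).
Local Notation D k x := (adic P k x).
Local Notation U x := (adic_unit P x).
(** Both [Phi n] and [PhiN n] meet these conditions, so the congruences modulo [P ^+ 2] are proved
    once for both. *)
Hypotheses (size_P : size P != 1%N) (U_q : U q) (U_1q : U (1 + q))
  (D_w : D 1 (1 - w)) (U_exp : forall m, ~~ (n %| m)%N -> U (1 - q ^+ (2 * m))).

Let q0 : q != 0. Proof. exact: adic_unit_neq0 U_q. Qed.
Let q1q : 1 + q != 0. Proof. exact: adic_unit_neq0 U_1q. Qed.
Let D_U x : U x -> D 0 x. Proof. exact: adic_unit_adic. Qed.
Let D_1 : D 0 1. Proof. exact/D_U/adic_unit1. Qed.
Let D_exp k : D 0 (q ^+ k). Proof. exact/D_U/adic_unitX. Qed.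
Let D_sign k : D 0 ((-1) ^+ k).
Proof. by rewrite -signr_odd; case: odd; rewrite ?expr1 ?expr0 //; apply: adicN. Qed.
Let D_qint x k : D 0 x -> D 0 (qint x k).
Proof. by move=> hx; apply: adic_sum => i; rewrite -[0%N](mul0n i); apply: adicX. Qed.

Let q_generic m : (0 < m)%N -> 1 - q ^+ m != 0.
Proof.
move=> m0; rewrite -rmorphXn -(rmorph1 iota) -rmorphB iota_neq0 //.
by rewrite -oppr_eq0 opprB -size_poly_eq0 size_XnsubC.
Qed.

Let U_w : U w. Proof. exact: adic_unitX. Qed.

Let coprime_n2 : coprime n 2. Proof. by rewrite coprimen2 /n addn1 mul2n /= odd_double. Qed.

Let U_poch4 k : (k <= 2 * N)%N -> U (qpoch (q ^+ 4) (q ^+ 4) k).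
Proof.
move=> le_k; apply: (@adic_unit_prod _ (fun i => 1 - q ^+ 4 * (q ^+ 4) ^+ i)).
move=> i lt_ik; have -> : q ^+ 4 * (q ^+ 4) ^+ i = q ^+ (2 * (2 * i.+1)).
  by rewrite -exprM -exprD; congr (_ ^+ _); lia.
by apply: U_exp; rewrite Gauss_dvdr // gtnNdvd //; lia.
Qed.

(** The exponents are twice the odd numbers [2 * i + 1], which stay below [n] for [i < N]; the
    factor at [i = N] is [1 - w], the first non-unit. *)
Let U_poch2 k : (k <= N)%N -> U (qpoch (q ^+ 2) (q ^+ 4) k).
Proof.
move=> le_k; apply: (@adic_unit_prod _ (fun i => 1 - q ^+ 2 * (q ^+ 4) ^+ i)).
move=> i lt_ik; have -> : q ^+ 2 * (q ^+ 4) ^+ i = q ^+ (2 * (2 * i + 1)).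
  by rewrite -exprM -exprD; congr (_ ^+ _); lia.
by apply: U_exp; rewrite gtnNdvd //; lia.
Qed.

Let D_poch a k : D 0 a -> D 0 (qpoch a (q ^+ 4) k).
Proof.
move=> ha; apply: big_ind => [|x y|i _] //; first exact: adicMl.
by apply: adicB => //; apply: adicMl => //; rewrite -exprM.
Qed.

Let poch_perturb a k : D 0 a ->
  D 2 (qpoch (a / w) (q ^+ 4) k * qpoch (a * w) (q ^+ 4) k - qpoch a (q ^+ 4) k ^+ 2).
Proof.
move=> ha; rewrite /qpoch -big_split /= expr2 -big_split /=.
have w0 := adic_unit_neq0 _ U_w.
have hax i : D 0 (a * (q ^+ 4) ^+ i) by apply: adicMl => //; rewrite -exprM.
have hV := D_U _ (adic_unitV _ U_w).
apply: (@eqmod_prod _ _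
  (fun i => (1 - a / w * (q ^+ 4) ^+ i) * (1 - a * w * (q ^+ 4) ^+ i))
  (fun i => (1 - a * (q ^+ 4) ^+ i) * (1 - a * (q ^+ 4) ^+ i))) => i _.
- rewrite mulrAC [a * w * _]mulrAC.
  by apply: adicMl => //; apply: adicB => //; apply: adicMl => //; apply: D_U.
- by apply: adicMl => //; apply: adicB.
have -> : (1 - a / w * (q ^+ 4) ^+ i) * (1 - a * w * (q ^+ 4) ^+ i)
          - (1 - a * (q ^+ 4) ^+ i) * (1 - a * (q ^+ 4) ^+ i)
        = - (a * (q ^+ 4) ^+ i * w^-1 * (1 - w) ^+ 2) by field.
by apply/adicN/adicMl; [apply: adicMl | apply: (@adicX 1 2)].
Qed.

Let c k := (-1) ^+ k * (((1 + q ^+ (4 * k + 1)) * qpoch (q ^+ 2) (q ^+ 4) k ^+ 2) /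
   ((1 + q) * qpoch (q ^+ 4) (q ^+ 4) k ^+ 2)) * q ^+ (2 * k ^ 2 + k).
(** Up to a sign and [1 + q], the term [c k] is [B k * h k ^+ 2]. The reflections treat the shifted
    factorials in [h] and the monomials in [B] separately. *)
Let h k := qpoch (q ^+ 2) (q ^+ 4) k / qpoch (q ^+ 4) (q ^+ 4) k.
Let B k := (1 + q ^+ (4 * k + 1)) * q ^+ (2 * k ^ 2 + k).
Let S := \sum_(k < N.+1) c k.
Let T := \sum_(k < N.+1) qpoch (q ^+ 2) (q ^+ 4) k
   / (qint q (4 * k + 1) * qpoch (q ^+ 4) (q ^+ 4) k) * q ^+ (2 * k).
Let R := qint (q ^+ 2) n * q ^+ (2 * N ^ 2) * T.

Let D_h k : (k <= 2 * N)%N -> D 0 (h k).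
Proof.
by move=> hk; apply: adicMl; [apply: D_poch|apply/D_U/adic_unitV/U_poch4].
Qed.

Let U_h k : (k <= N)%N -> U (h k).
Proof.
move=> hk; apply: adic_unitM; first exact: U_poch2.
by apply/adic_unitV/U_poch4; lia.
Qed.

Let D_B k : D 0 (B k).
Proof. by apply: adicMl => //; apply: adicD. Qed.

Let cE k : c k = (-1) ^+ k / (1 + q) * (B k * h k ^+ 2).
Proof. by rewrite /c /B /h !invfM; ring. Qed.

Let D_sign1q k : D 0 ((-1) ^+ k / (1 + q)).
Proof. by apply: adicMl => //; apply/D_U/adic_unitV. Qed.

Let D_c k : (k <= 2 * N)%N -> D 0 (c k).
Proof.
move=> hk; rewrite cE; apply: adicMl => //; apply: adicMl => //.
by apply: (@adicX 0 2); apply: D_h.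
Qed.

Let U_12 : U (1 - q ^+ 2).
Proof. by apply: (U_exp 1); rewrite gtnNdvd // /n; lia. Qed.

(** If [n] divides [4 * k + 1], which is at most [2 * n - 1], the two are equal and the quotient is
    [(1 + q ^+ n) / (1 + q)]. Otherwise [1 / [4k+1]] lies in the localization and [[n]] in base
    [q ^+ 2] contains [1 - w]. *)
Let ratio_qint k : (k <= N)%N ->
  D 0 (qint (q ^+ 2) n / qint q (4 * k + 1)) /\
  (D 1 (1 + q ^+ n) -> D 1 (qint (q ^+ 2) n / qint q (4 * k + 1))).
Proof.
move=> le_k; set m := (4 * k + 1)%N.
have h1 : 1 - q != 0 by rewrite -[q]expr1 q_generic.
have h2 : 1 - q ^+ 2 != 0 by rewrite q_generic.
have hm : 1 - q ^+ m != 0 by rewrite q_generic // /m addn1.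
have -> : qint q m = (1 - q ^+ m) / (1 - q) by rewrite -qintE mulrAC divff // mul1r.
have E : qint (q ^+ 2) n = (1 - w) / (1 - q ^+ 2).
  by rewrite /w exprM -qintE mulrAC divff // mul1r.
have [/dvdnP[j mE]|nm] := boolP (n %| m)%N.
  have {mE} -> : m = n by move: mE le_k; rewrite /m /n; case: j => [|[|j]]; nia.
  have hn : 1 - q ^+ n != 0 by rewrite q_generic // /n addn1.
  have -> : qint (q ^+ 2) n / ((1 - q ^+ n) / (1 - q)) = (1 + q ^+ n) * (1 + q)^-1.
    by rewrite E /w mulnC exprM; field; rewrite hn h2 h1 q1q.
  have hV := D_U _ (adic_unitV _ U_1q).
  split=> [|hn1]; last exact: adicMr.
  by apply: adicMl => //; apply: adicD.
have U2m := U_exp m nm.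
have -> : qint (q ^+ 2) n / ((1 - q ^+ m) / (1 - q))
  = qint (q ^+ 2) n * ((1 - q) * (1 + q ^+ m) / (1 - q ^+ (2 * m))).
  have E2 : 1 - q ^+ (2 * m) = (1 - q ^+ m) * (1 + q ^+ m) by rewrite mulnC exprM; ring.
  have hm2 : 1 - q ^+ (2 * m) != 0 by apply: adic_unit_neq0 U2m.
  rewrite E2; have : 1 + q ^+ m != 0 by move: hm2; rewrite E2 mulf_eq0 negb_or => /andP[].
  by move=> hm3; field; rewrite hm hm3 h1.
have hr : D 0 ((1 - q) * (1 + q ^+ m) / (1 - q ^+ (2 * m))).
  apply: adicMl; last exact/D_U/adic_unitV.
  apply: adicMl; last exact: adicD.
  by apply: adicB => //; apply: D_U.
split=> [|_]; first by apply: adicMl => //; apply: D_qint.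
apply: adicMr => //; rewrite E; apply: adicMr => //.
by apply/D_U/adic_unitV/U_12.
Qed.

Let num k := qpoch (q ^+ 2 / w) (q ^+ 4) k * qpoch (q ^+ 2 * w) (q ^+ 4) k.
Let den k := qpoch (q ^+ 4 / w) (q ^+ 4) k * qpoch (q ^+ 4 * w) (q ^+ 4) k.

Let D_num k : D 0 (num k).
Proof.
have hV := D_U _ (adic_unitV _ U_w).
by apply: adicMl; apply: D_poch; apply: adicMl => //; apply: D_U.
Qed.

Let c_perturb k : (k <= N)%N ->
  D 2 (c k - (-1) ^+ k * ((1 + q ^+ (4 * k + 1)) / (1 + q)) * q ^+ (2 * k ^ 2 + k)
             * (num k / den k)).
Proof.
move=> le_k; have -> : c k = (-1) ^+ k * ((1 + q ^+ (4 * k + 1)) / (1 + q))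
     * q ^+ (2 * k ^ 2 + k) * (qpoch (q ^+ 2) (q ^+ 4) k ^+ 2 / qpoch (q ^+ 4) (q ^+ 4) k ^+ 2).
  by rewrite /c !invfM; ring.
rewrite -mulrBr; apply: adicMl.
  have V1q := D_U _ (adic_unitV _ U_1q).
  by do !apply: adicMl => //; apply: adicD.
have hd : D 2 (den k - qpoch (q ^+ 4) (q ^+ 4) k ^+ 2) by apply: poch_perturb.
have U4 : U (qpoch (q ^+ 4) (q ^+ 4) k ^+ 2) by apply/adic_unitX/U_poch4; lia.
have hd' : D 2 (qpoch (q ^+ 4) (q ^+ 4) k ^+ 2 - den k) by rewrite -opprB; apply: adicN.
(* The perturbed denominator is congruent to a unit, hence is one. *)
have Ud : U (den k) by apply: adic_unit_eqmod U4 (adicW 2 1 _ isT hd').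
rewrite -opprB; apply/adicN/eqmodM => //.
- exact/D_U/adic_unitV.
- exact: poch_perturb.
- exact: eqmodV.
Qed.

(** Undoing the perturbation on both sides of the exact identity costs only multiples of [P ^+ 2].
    On the right, [[4k+1]] may fail to be a unit and has to be absorbed by the prefactor [[n]]. *)
Lemma truncated_sum_eqmod : D 2 (S - (-1) ^+ N * R).
Proof.
have := perturbed_identity F q q0 q_generic N; cbv zeta.
rewrite -/n -/w => H.
have -> : S - (-1) ^+ N * R = \sum_(k < N.+1) (c k -
    (-1) ^+ k * ((1 + q ^+ (4 * k + 1)) / (1 + q)) * q ^+ (2 * k ^ 2 + k)
             * (num k / den k))
  - (-1) ^+ N * qint (q ^+ 2) n * q ^+ (2 * N ^ 2) *
    \sum_(k < N.+1) (qpoch (q ^+ 2) (q ^+ 4) k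
         / (qint q (4 * k + 1) * qpoch (q ^+ 4) (q ^+ 4) k) * q ^+ (2 * k)
       - num k / (qint q (4 * k + 1) * qpoch (q ^+ 2) (q ^+ 4) k * qpoch (q ^+ 4) (q ^+ 4) k)
       * q ^+ (2 * k)).
  by rewrite !sumrB /num /den H /S /R /T; ring.
apply: adicB; first by apply: adic_sum => k; apply: c_perturb; rewrite -ltnS.
rewrite mulr_sumr; apply: adic_sum => k.
have le_k : (k <= N)%N by rewrite -ltnS.
have [hr _] := ratio_qint _ le_k; have U2 := U_poch2 _ le_k.
have V4 : D 0 (qpoch (q ^+ 4) (q ^+ 4) k)^-1 by apply/D_U/adic_unitV/U_poch4; lia.
have V2 := D_U _ (adic_unitV _ U2).
(* Extending the fraction by [qpoch (q ^+ 2) (q ^+ 4) k] exposes the square that [num k]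
   perturbs. *)
have -> : qpoch (q ^+ 2) (q ^+ 4) k / (qint q (4 * k + 1) * qpoch (q ^+ 4) (q ^+ 4) k)
  = qpoch (q ^+ 2) (q ^+ 4) k ^+ 2 / (qint q (4 * k + 1)
      * qpoch (q ^+ 2) (q ^+ 4) k * qpoch (q ^+ 4) (q ^+ 4) k).
  rewrite !invfM; move: (adic_unit_neq0 _ U2) (_^-1) (_^-1) => h0 x y.
  by field.
have -> : forall a b I P2 P4 s e : F,
  s * qint (q ^+ 2) n * e * (a / (I * P2 * P4) * q ^+ (2 * k) - b / (I * P2 * P4) * q ^+ (2 * k))
  = s * e * (qint (q ^+ 2) n / I) * (P2^-1 * P4^-1) * q ^+ (2 * k) * - (b - a).
  by move=> *; rewrite !invfM; ring.
apply: adicMl; last by apply/adicN/poch_perturb.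
by do !apply: adicMl => //.
Qed.

Let D_ratio_T k e : (k <= N)%N -> D e (qint (q ^+ 2) n / qint q (4 * k + 1)) ->
  D e (qint (q ^+ 2) n * q ^+ (2 * N ^ 2) * (qpoch (q ^+ 2) (q ^+ 4) k
   / (qint q (4 * k + 1) * qpoch (q ^+ 4) (q ^+ 4) k) * q ^+ (2 * k))).
Proof.
move=> le_k hr; have V4 : D 0 (qpoch (q ^+ 4) (q ^+ 4) k)^-1.
  by apply/D_U/adic_unitV/U_poch4; lia.
rewrite invfM; have -> : forall I Q4 X : F,
  qint (q ^+ 2) n * q ^+ (2 * N ^ 2) * (X * (I * Q4) * q ^+ (2 * k))
  = q ^+ (2 * N ^ 2) * X * Q4 * q ^+ (2 * k) * (qint (q ^+ 2) n * I).
  by move=> *; ring.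
by apply: adicMl => //; do !apply: adicMl => //; apply: D_poch.
Qed.

Let D_R : D 0 R.
Proof.
rewrite /R /T mulr_sumr; apply: adic_sum => k.
have le_k : (k <= N)%N by rewrite -ltnS.
by apply: D_ratio_T => //; case: (ratio_qint _ le_k).
Qed.

Let D1_R : D 1 (1 + q ^+ n) -> D 1 R.
Proof.
move=> hq; rewrite /R /T mulr_sumr; apply: adic_sum => k.
have le_k : (k <= N)%N by rewrite -ltnS.
by apply: D_ratio_T => //; case: (ratio_qint _ le_k) => _; apply.
Qed.

Let D_S : D 0 S.
Proof. by apply: adic_sum => k; apply: D_c; have := ltn_ord k; lia. Qed.

Let u m := c (N.+1 + m).
(** This is [h (N.+1 + m)] with the factor [1 - w] of its numerator, the one at index [N], taken
    out. *)
Let g m := qpoch (q ^+ 2) (q ^+ 4) N * qpoch (w * q ^+ 4) (q ^+ 4) m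
           / qpoch (q ^+ 4) (q ^+ 4) (N.+1 + m).

Let D_g m : (m < N)%N -> D 0 (g m).
Proof.
move=> lt_m; apply: adicMl; last by apply/D_U/adic_unitV/U_poch4; lia.
by apply: adicMl; apply: D_poch => //; apply: adicMl => //; apply: D_U.
Qed.

Let hE m : h (N.+1 + m) = (1 - w) * g m.
Proof.
rewrite /h qpochD qpochSr.
have -> : q ^+ 2 * (q ^+ 4) ^+ N = w.
  by rewrite -exprM -exprD; congr (_ ^+ _); rewrite /n; lia.
have -> : q ^+ 2 * (q ^+ 4) ^+ N.+1 = w * q ^+ 4.
  by rewrite -exprM -!exprD; congr (_ ^+ _); rewrite /n; lia.
by rewrite /g; ring.
Qed.

Let uE m : u m = (1 - w) ^+ 2 *
   ((-1) ^+ (N.+1 + m) / (1 + q) * (B (N.+1 + m) * g m ^+ 2)).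
Proof. by rewrite /u cE hE; ring. Qed.

Let D2_w : D 2 ((1 - w) ^+ 2).
Proof. exact: (@adicX 1 2). Qed.

Let D2_u m : (m < N)%N -> D 2 (u m).
Proof.
move=> lt_m; rewrite uE; apply: adicMr => //.
apply: adicMl => //; apply: adicMl => //.
by apply: (@adicX 0 2); apply: D_g.
Qed.

Let A l := \sum_(j < l) c j.

Let D_A l : (l <= N.+1)%N -> D 0 (A l).
Proof. by move=> hl; apply: adic_sum => j; apply: D_c; have := ltn_ord j; lia. Qed.

Lemma double_sum_eqmod2 :
  D 2 (\sum_(k < n) \sum_(j < k.+1) c j * c (k - j)%N - R ^+ 2).
Proof.
rewrite double_sum_split -/S.
have sq : ((-1) ^+ N) ^+ 2 = 1 :> F by rewrite -exprM mulnC exprM sqrrN !expr1n.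
rewrite addrAC; apply: adicD.
  have -> : S ^+ 2 - R ^+ 2 = (S - (-1) ^+ N * R) * (S + (-1) ^+ N * R).
    by rewrite -subr_sqr [((-1) ^+ N * R) ^+ 2]exprMn sq mul1r.
  apply: adicMr; first exact: truncated_sum_eqmod.
  by apply: adicD => //; apply: adicMl.
rewrite mulr2n; apply: adicD; apply: adic_sum => i; apply: adicMr;
  by [exact: D2_u | apply: D_A; lia].
Qed.

(** * Reflections modulo a divisor of [1 + q^n] *)

Section Reflection.
Hypothesis D_qn : D 1 (1 + q ^+ n).

Let sign_eqmod i : D 1 ((-1) ^+ i - q ^+ (n * i)).
Proof.
elim: i => [|i IHi]; first by rewrite muln0 !expr0 subrr; apply: adic0.
have -> : (-1) ^+ i.+1 - q ^+ (n * i.+1)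
    = - ((-1) ^+ i - q ^+ (n * i)) - q ^+ (n * i) * (1 + q ^+ n).
  by rewrite mulnS exprD exprS; ring.
by apply: adicB; [apply: adicN | apply: adicMl].
Qed.

(** As [q ^+ n] is congruent to -1, a sign [(-1) ^+ i] counts as [q ^+ (n * i)]; congruences of
    signed monomials become equalities of natural exponents. *)
Let exp_eqmod a b i j : (a + n * i = b + n * j)%N ->
  D 1 ((-1) ^+ i * q ^+ a - (-1) ^+ j * q ^+ b).
Proof.
move=> E; have -> : (-1) ^+ i * q ^+ a - (-1) ^+ j * q ^+ b
    = q ^+ a * ((-1) ^+ i - q ^+ (n * i)) - q ^+ b * ((-1) ^+ j - q ^+ (n * j)).
  have : q ^+ a * q ^+ (n * i) = q ^+ b * q ^+ (n * j) by rewrite -!exprD E.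
  by rewrite !mulrBr => ->; ring.
by apply: adicB; apply: adicMl.
Qed.

Let hS k : (k < N)%N -> h k.+1 = h k * ((1 - q ^+ (4 * k + 2)) / (1 - q ^+ (4 * k + 4))).
Proof.
move=> lt_k; rewrite /h !qpochSr -!exprM -!exprD.
have -> : (2 + 4 * k = 4 * k + 2)%N by lia.
have -> : (4 + 4 * k = 4 * k + 4)%N by lia.
by rewrite !invfM; ring.
Qed.

Let U_even k : (k < N)%N -> U (1 - q ^+ (4 * k + 4)).
Proof.
move=> lt_k; have -> : (4 * k + 4 = 2 * (2 * k.+1))%N by lia.
by apply: U_exp; rewrite Gauss_dvdr // gtnNdvd //; lia.
Qed.

Let U_odd k : (k < N)%N -> U (1 - q ^+ (4 * k + 2)).
Proof.
move=> lt_k; have -> : (4 * k + 2 = 2 * (2 * k + 1))%N by lia.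
by apply: U_exp; rewrite gtnNdvd //; lia.
Qed.

(** Induction on [k], starting from [h 0 = 1]. For [j + k.+1 = N] the exponents [4 * j + 2], [2] and
    [4 * k + 2] add up to [2 * n], so the successive ratios of [h] at [j] and [k] differ by a
    multiple of [1 - w]. *)
Lemma h_reflect j k : (j + k = N)%N -> D 1 (h j - h N * q ^+ (2 * k) * h k).
Proof.
elim: k j => [|k IHk] j jk.
  have -> : j = N by lia.
  rewrite muln0 expr0 {3}/h !qpoch0 divr1 !mulr1 subrr; exact: adic0.
have lt_j : (j < N)%N by lia. have lt_k : (k < N)%N by lia.
have {}IHk := IHk j.+1 _; have {IHk}IH := IHk ltac:(lia).
have Ua := U_even _ lt_j; have Ub := U_odd _ lt_j.
have Ua' := U_even _ lt_k; have Ub' := U_odd _ lt_k.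
have -> : h j = h j.+1 * ((1 - q ^+ (4 * j + 4)) / (1 - q ^+ (4 * j + 2))).
  by rewrite hS //; field; rewrite !adic_unit_neq0.
have -> : h N * q ^+ (2 * k.+1) * h k.+1 = h N * q ^+ (2 * k) * h k
    * (q ^+ 2 * ((1 - q ^+ (4 * k + 2)) / (1 - q ^+ (4 * k + 4)))).
  by rewrite hS // mulnS exprD; ring.
apply: eqmodM => //; first by apply: D_h; lia.
  apply: adicMl => //; apply: adicMl; last exact/D_U/adic_unitV.
  exact: D_U.
have -> : (1 - q ^+ (4 * j + 4)) / (1 - q ^+ (4 * j + 2))
     - q ^+ 2 * ((1 - q ^+ (4 * k + 2)) / (1 - q ^+ (4 * k + 4)))
   = (1 - q ^+ 2) * (1 - w) * ((1 - q ^+ (4 * j + 2))^-1 * (1 - q ^+ (4 * k + 4))^-1).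
  have -> : w = q ^+ (4 * j + 2) * q ^+ 2 * q ^+ (4 * k + 2).
    by rewrite -!exprD; congr (_ ^+ _); rewrite /n; lia.
  have := adic_unit_neq0 _ Ub; have := adic_unit_neq0 _ Ua'.
  have -> : (4 * j + 4 = 4 * j + 2 + 2)%N by lia.
  have -> : (4 * k + 4 = 4 * k + 2 + 2)%N by lia.
  rewrite !(exprD _ (_ + 2) 2); move: (q ^+ (4 * j + 2)) (q ^+ (4 * k + 2)) => y x hx hy.
  by field; rewrite hx hy.
apply: adicMr; last by apply: adicMl; apply/D_U/adic_unitV.
by apply: adicMl => //; apply: adicB.
Qed.

Let hN_sq : D 1 (1 - h N ^+ 2 * q ^+ (2 * N)).
Proof.
have := h_reflect 0 N (add0n N); rewrite {1}/h !qpoch0 divr1.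
by rewrite mulrAC -expr2.
Qed.

Let D_sq k x y : D 0 x -> D 0 y -> D k (x - y) -> D k (x ^+ 2 - y ^+ 2).
Proof. by move=> hx hy hxy; rewrite !expr2; apply: eqmodM. Qed.

Let D_hN : D 0 (h N). Proof. by apply: D_h; lia. Qed.

(** Squaring the reflection of [h] produces [h N ^+ 2], which is congruent to the inverse of
    [q ^+ (2 * N)]; the reflection of [B] supplies the minus sign. *)
Lemma c_reflect j k : (j + k = N)%N -> D 1 (c j + c k).
Proof.
move=> jk; have hj : D 0 (h j) by apply: D_h; lia.
have hk : D 0 (h k) by apply: D_h; lia.
have D2 x : D 0 x -> D 0 (x ^+ 2) by exact: (@adicX 0 2).
have hjk : D 1 (h j ^+ 2 - h N ^+ 2 * q ^+ (4 * k) * h k ^+ 2).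
  have -> : h N ^+ 2 * q ^+ (4 * k) * h k ^+ 2 = (h N * q ^+ (2 * k) * h k) ^+ 2.
    by rewrite -[4%N]/(2 * 2)%N -mulnA mulnC exprM !exprMn.
  apply: D_sq => //; last exact: h_reflect.
  by do !apply: adicMl => //.
have hB : D 1 (B j * q ^+ (4 * k) + (-1) ^+ N * q ^+ (2 * N) * B k).
  (* The first monomial of [B j] is matched with the second of [B k], and in [e2] the second with
     the first. The multiples of [n] balance the exponents and have the parities that give the
     signs. *)
  have e1 : (2 * j ^ 2 + j + 4 * k + n * (2 * k + 1)
             = 2 * N + 2 * k ^ 2 + 5 * k + 1 + n * N)%N by rewrite /n -jk; lia.
  have e2 : (2 * j ^ 2 + 5 * j + 1 + 4 * k + n * (2 * k)
             = 2 * N + 2 * k ^ 2 + k + n * N.+1)%N by rewrite /n -jk; lia.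
  have := adicD _ _ _ (adicN _ _ (exp_eqmod _ _ _ _ e1)) (exp_eqmod _ _ _ _ e2).
  rewrite addn1 [(-1) ^+ (2 * k).+1]exprS [(-1) ^+ N.+1]exprS.
  have -> : (-1) ^+ (2 * k) = 1 :> F by rewrite exprM sqrrN !expr1n.
  set X := _ + _; set Y := _ + _; suff -> : X = Y by [].
  rewrite /X /Y /B !mulrDl !mul1r -!exprD.
  have -> : (4 * j + 1 + (2 * j ^ 2 + j) + 4 * k = 2 * j ^ 2 + 5 * j + 1 + 4 * k)%N by lia.
  rewrite !mulrDr -!mulrA -!exprD.
  have -> : (2 * N + (2 * k ^ 2 + k) = 2 * N + 2 * k ^ 2 + k)%N by lia.
  have -> : (2 * N + (4 * k + 1 + (2 * k ^ 2 + k)) = 2 * N + 2 * k ^ 2 + 5 * k + 1)%N by lia.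
  by ring.
have sgn : (-1) ^+ j * (-1) ^+ N = (-1) ^+ k :> F.
  by rewrite -exprD -jk addnA addnn -mul2n exprD exprM sqrrN !expr1n mul1r.
have -> : c j + c k = (-1) ^+ j / (1 + q) *
   (B j * (h j ^+ 2 - h N ^+ 2 * q ^+ (4 * k) * h k ^+ 2)
    + h N ^+ 2 * h k ^+ 2 * (B j * q ^+ (4 * k) + (-1) ^+ N * q ^+ (2 * N) * B k)
    + (-1) ^+ N * h k ^+ 2 * B k * (1 - h N ^+ 2 * q ^+ (2 * N))).
  by rewrite !cE -sgn; ring.
apply: adicMl => //; apply: adicD; first apply: adicD.
- exact: adicMl.
- by apply: adicMl => //; apply: adicMl; apply: D2.
- by apply: adicMl => //; do !apply: adicMl => //; apply: D2.
Qed.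

(** The value of [g m / h N] when [w] is set to 1 in its shifted factorials. *)
Let kappa m := (h m * (1 - q ^+ (4 * m + 2)))^-1.

Let U_kappa m : (m < N)%N -> U (kappa m).
Proof.
by move=> lt_m; apply/adic_unitV/adic_unitM; [apply: U_h; lia | apply: U_odd].
Qed.

Let g_kappa m : (m < N)%N -> D 1 (g m - h N * kappa m).
Proof.
move=> lt_m.
(* Splitting the denominator of [g m] after [N] factors yields [h N]; the remaining factors start at
   [q ^+ 4 * (q ^+ 4) ^+ N = w * q ^+ 2]. *)
have gE : g m = h N * (qpoch (w * q ^+ 4) (q ^+ 4) m / qpoch (w * q ^+ 2) (q ^+ 4) m.+1).
  rewrite /g /h addSnnS qpochD.
  have -> : q ^+ 4 * (q ^+ 4) ^+ N = w * q ^+ 2.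
    by rewrite -exprM -!exprD; congr (_ ^+ _); rewrite /n; lia.
  by rewrite !invfM; ring.
have kE : kappa m = qpoch (q ^+ 4) (q ^+ 4) m / qpoch (q ^+ 2) (q ^+ 4) m.+1.
  rewrite /kappa /h qpochSr -exprM -exprD [(2 + _)%N]addnC !invfM invrK; ring.
have shift x k : D 0 x -> D 1 (qpoch (w * x) (q ^+ 4) k - qpoch x (q ^+ 4) k).
  move=> hx; have hxi i : D 0 (x * (q ^+ 4) ^+ i) by apply: adicMl => //; rewrite -exprM.
  apply: (@eqmod_prod _ _ (fun i => 1 - w * x * (q ^+ 4) ^+ i)
           (fun i => 1 - x * (q ^+ 4) ^+ i)) => i _.
  - by rewrite -mulrA; apply: adicB => //; apply: adicMl => //; apply: D_U.
  - exact: adicB.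
  have -> : 1 - w * x * (q ^+ 4) ^+ i - (1 - x * (q ^+ 4) ^+ i)
     = x * (q ^+ 4) ^+ i * (1 - w) by ring.
  exact: adicMl.
rewrite gE kE -mulrBr; apply: adicMl => //.
have U2 : U (qpoch (q ^+ 2) (q ^+ 4) m.+1) by apply: U_poch2.
have hs := shift (q ^+ 2) m.+1 (D_exp 2).
have Us : U (qpoch (w * q ^+ 2) (q ^+ 4) m.+1).
  by apply: (adic_unit_eqmod _ _ size_P U2); rewrite -opprB; apply: adicN.
apply: eqmodM.
- by apply: D_poch; apply: adicMl => //; apply: D_U.
- exact/D_U/adic_unitV.
- exact: shift.
- exact: eqmodV.
Qed.

(** This inverts the reflection of [h] between [l] and [m.+1]. As [w] is [q ^+ (4 * l + 2)] times
    [q ^+ (4 * m + 4)], the factor [1 - q ^+ (4 * l + 2)] is congruent to a negative power of [q]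
    times [-(1 - q ^+ (4 * m + 4))]. *)
Let kappa_reflect l m : (l + m.+1 = N)%N ->
  D 1 (h N * kappa l - - (q ^+ (2 * m + 2) * kappa m)).
Proof.
move=> lm; have lt_m : (m < N)%N by lia. have lt_l : (l < N)%N by lia.
have hr := h_reflect l m.+1 lm.
have Ul : U (h l) by apply: U_h; lia. have Um : U (h m.+1) by apply: U_h.
have Ua := U_even _ lt_m; have Ub := U_odd _ lt_m; have Ub' := U_odd _ lt_l.
have kE : kappa m = (h m.+1 * (1 - q ^+ (4 * m + 4)))^-1.
  by rewrite /kappa hS // -mulrA divfK // adic_unit_neq0.
rewrite kE /kappa opprK.
have -> : h N / (h l * (1 - q ^+ (4 * l + 2)))
    + q ^+ (2 * m + 2) * (h m.+1 * (1 - q ^+ (4 * m + 4)))^-1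
  = (h N * h m.+1 * (1 - w)
     + q ^+ (2 * m + 2) * (1 - q ^+ (4 * l + 2)) * (h l - h N * q ^+ (2 * m.+1) * h m.+1))
    * ((h l * (1 - q ^+ (4 * l + 2)))^-1 * (h m.+1 * (1 - q ^+ (4 * m + 4)))^-1).
  have := adic_unit_neq0 _ Ul; have := adic_unit_neq0 _ Um.
  have := adic_unit_neq0 _ Ub'; have := adic_unit_neq0 _ Ua.
  have -> : w = q ^+ (4 * l + 2) * (q ^+ (2 * m + 2)) ^+ 2.
    by rewrite -exprM -exprD; congr (_ ^+ _); rewrite /n; lia.
  have -> : q ^+ (4 * m + 4) = (q ^+ (2 * m + 2)) ^+ 2.
    by rewrite -exprM; congr (_ ^+ _); lia.
  have -> : (2 * m.+1 = 2 * m + 2)%N by lia.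
  move: (q ^+ (2 * m + 2)) (q ^+ (4 * l + 2)) (h l) (h m.+1) (h N) => x y a b e h1 h2 h3 h4.
  by field; rewrite h1 h2 h3 h4.
apply: adicMr; last by apply: adicMl; apply/D_U/adic_unitV/adic_unitM.
have D_l := D_U _ Ul; have D_m := D_U _ Um.
by apply: adicD; apply: adicMl => //; apply: adicMl => //; apply: adicB.
Qed.

(** With [(1 - w) ^+ 2] taken out, only a congruence modulo [P] is left. It follows the pattern of
    [c_reflect], with [g] reduced to [kappa] in place of [h]. *)
Lemma u_reflect l m : (l + m.+1 = N)%N -> D 3 (u l + u m).
Proof.
move=> lm; have lt_m : (m < N)%N by lia. have lt_l : (l < N)%N by lia.
have D_gl := D_g _ lt_l; have D_gm := D_g _ lt_m.
have D_kl := D_U _ (U_kappa _ lt_l); have D_km := D_U _ (U_kappa _ lt_m).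
have D2 x : D 0 x -> D 0 (x ^+ 2) by exact: (@adicX 0 2).
have hl : D 1 (g l ^+ 2 - q ^+ (4 * m + 4) * kappa m ^+ 2).
  have -> : q ^+ (4 * m + 4) * kappa m ^+ 2 = (- (q ^+ (2 * m + 2) * kappa m)) ^+ 2.
    by rewrite sqrrN exprMn -exprM; congr (_ ^+ _ * _); lia.
  apply: D_sq => //; first by apply/adicN/adicMl.
  have -> : g l - - (q ^+ (2 * m + 2) * kappa m) = g l - h N * kappa l
    + (h N * kappa l - - (q ^+ (2 * m + 2) * kappa m)) by ring.
  by apply: adicD; [apply: g_kappa | apply: kappa_reflect].
have hm : D 1 (g m ^+ 2 - h N ^+ 2 * kappa m ^+ 2).
  by rewrite -exprMn; apply: D_sq => //; [apply: adicMl | apply: g_kappa].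
have hB : D 1 (q ^+ (2 * N + 4 * m + 4) * B (N.+1 + l)
               + - (-1) ^+ N * B (N.+1 + m)).
  (* As before, opposite monomials of the two [B] factors are matched; here the multiples of [n]
     leave the sign [(-1) ^+ N] on one side. *)
  have e1 : (2 * N + 4 * m + 4 + (2 * (N.+1 + l) ^ 2 + (N.+1 + l)) + n * (6 * m + 4)
     = 4 * (N.+1 + m) + 1 + (2 * (N.+1 + m) ^ 2 + (N.+1 + m)) + n * (2 * N + N))%N.
    by rewrite /n -lm; lia.
  have e2 : (2 * N + 4 * m + 4 + (4 * (N.+1 + l) + 1 + (2 * (N.+1 + l) ^ 2 + (N.+1 + l)))
        + n * (6 * m)
     = 2 * (N.+1 + m) ^ 2 + (N.+1 + m) + n * (2 * (N + 1) + N))%N.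
    by rewrite /n -lm; lia.
  have even_sign k r : (-1) ^+ (2 * k + r) = (-1) ^+ r :> F.
    by rewrite exprD exprM sqrrN !expr1n mul1r.
  have := adicD _ _ _ (exp_eqmod _ _ _ _ e1) (exp_eqmod _ _ _ _ e2).
  rewrite !even_sign.
  have -> : (6 * m + 4 = 2 * (3 * m + 2) + 0)%N by lia.
  have -> : (6 * m = 2 * (3 * m) + 0)%N by lia.
  rewrite !even_sign !exprD expr0; set X := _ + _; set Y := _ + _.
  by suff -> : X = Y; last by rewrite /X /Y /B !exprD; ring.
have sgn : (-1) ^+ l = - ((-1) ^+ m * (-1) ^+ N) :> F.
  have sq : (-1) ^+ m * (-1) ^+ m = 1 :> F by rewrite -exprMn mulrNN mulr1 expr1n.
  rewrite -lm exprD exprSr; transitivity ((-1) ^+ l * ((-1) ^+ m * (-1) ^+ m) : F).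
    by rewrite sq mulr1.
  by ring.
have -> : u l + u m = (1 - w) ^+ 2 * ((-1) ^+ N.+1 / (1 + q) *
   ((-1) ^+ l * B (N.+1 + l) * (g l ^+ 2 - q ^+ (4 * m + 4) * kappa m ^+ 2)
    + (-1) ^+ l * B (N.+1 + l) * (q ^+ (4 * m + 4) * kappa m ^+ 2)
      * (1 - h N ^+ 2 * q ^+ (2 * N))
    + (-1) ^+ m * B (N.+1 + m) * (g m ^+ 2 - h N ^+ 2 * kappa m ^+ 2)
    + h N ^+ 2 * kappa m ^+ 2 * ((-1) ^+ l *
       (q ^+ (2 * N + 4 * m + 4) * B (N.+1 + l) + - (-1) ^+ N * B (N.+1 + m))))).
  rewrite !uE !(exprD (-1)) (_ : (-1) ^+ m = - (-1) ^+ l * (-1) ^+ N); last first.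
    by rewrite sgn opprK -mulrA -expr2 -exprM mulnC exprM sqrrN !expr1n mulr1.
  rewrite -(addnA (2 * N)) (exprD q (2 * N)); ring.
apply: (@adicM 2 1) => //; apply: adicMl => //.
have D_k2 := D2 _ D_km; have D_N2 := D2 _ D_hN.
do !apply: adicD; apply: adicMl => //; do ?[exact: adicMl | apply: adicMl => //].
Qed.

(** [S ^+ 2 - R ^+ 2] is a product of a multiple of [P ^+ 2] and a multiple of [P], because [R] and
    hence [S] vanish modulo [P]. The tail gains its third factor [P] by pairing [i] with
    [N - i.+1]. *)
Lemma double_sum_eqmod3 :
  D 3 (\sum_(k < n) \sum_(j < k.+1) c j * c (k - j)%N - R ^+ 2).
Proof.
have D1R := D1_R D_qn.
have D1S : D 1 S.
  have -> : S = (S - (-1) ^+ N * R) + (-1) ^+ N * R by ring.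
  apply: adicD; last exact: adicMl.
  exact: adicW truncated_sum_eqmod.
rewrite double_sum_split -/S.
have sq : ((-1) ^+ N) ^+ 2 = 1 :> F by rewrite -exprM mulnC exprM sqrrN !expr1n.
rewrite addrAC; apply: adicD.
  have -> : S ^+ 2 - R ^+ 2 = (S - (-1) ^+ N * R) * (S + (-1) ^+ N * R).
    by rewrite -subr_sqr [((-1) ^+ N * R) ^+ 2]exprMn sq mul1r.
  apply: (@adicM 2 1); first exact: truncated_sum_eqmod.
  by apply: adicD => //; apply: adicMl.
have -> : \sum_(i < N) c (N.+1 + i)%N * \sum_(j < N - i) c j
   = \sum_(i < N) u i * A (N - i) by [].
(* The tail occurs twice; reversing only its second copy puts the paired terms under one sum. *)
rewrite mulr2n {2}(reindex_inj rev_ord_inj) /= -big_split /=.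
apply: adic_sum => i; have lt_i := ltn_ord i.
rewrite (_ : N - (N - i.+1) = i.+1)%N; last by lia.
(* Completing [A (N - i)] to [S] adds the reflections of the terms of [A i.+1], and each term
   cancels its reflection modulo [P]. *)
have D_A1 : D 1 (A (N - i) - A i.+1).
  have E : S = A (N - i) + \sum_(j < i.+1) c (N - j)%N.
    rewrite /S (_ : N.+1 = (N - i) + i.+1)%N; last by lia.
    rewrite big_split_ord /=; congr (_ + _).
    rewrite (reindex_inj rev_ord_inj) /=; apply: eq_bigr => j _; congr c.
    by have := ltn_ord j; lia.
  have -> : A (N - i) - A i.+1 = S - \sum_(j < i.+1) (c (N - j)%N + c j).
    by rewrite E big_split /A /=; ring.
  apply: adicB => //; apply: adic_sum => j; apply: c_reflect.
  by have := ltn_ord j; lia.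
have -> : u i * A (N - i) + u (N - i.+1)%N * A i.+1
  = u i * (A (N - i) - A i.+1) + (u (N - i.+1)%N + u i) * A i.+1 by ring.
apply: adicD; first by apply: (@adicM 2 1) => //; apply: D2_u.
apply: adicMr; first by apply: u_reflect; lia.
by apply: D_A; lia.
Qed.

End Reflection.

End Congruences.
End Fixed.

(** * Combination of the two coprime moduli *)

Lemma double_sum_reduced (n : nat) (q := iota 'X)
  (c := fun k => (-1) ^+ k *
    (((1 + q ^+ (4 * k + 1)) * qpoch (q ^+ 2) (q ^+ 4) k ^+ 2) /
     ((1 + q) * qpoch (q ^+ 4) (q ^+ 4) k ^+ 2)) * q ^+ (2 * k ^ 2 + k)) :
  (1 < n)%N -> odd n ->
  exists u v : {poly rat}, [/\ v != 0, coprimep u v,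
    \sum_(k < n) \sum_(j < k.+1) c j * c (k - j)%N
    - qint (q ^+ 2) n ^+ 2 * q ^+ ((n - 1) ^ 2) *
      (\sum_(k < ((n - 1) %/ 2).+1) qpoch (q ^+ 2) (q ^+ 4) k /
         (qint q (4 * k + 1) * qpoch (q ^+ 4) (q ^+ 4) k) * q ^+ (2 * k)) ^+ 2
    = iota u / iota v, PhiN n ^+ 3 * Phi n ^+ 2 %| u
    & coprimep v (PhiN n ^+ 3 * Phi n ^+ 2)].
Proof.
move=> n_gt1 n_odd; apply: adic_reduced; first exact: coprime_Phi_PhiN.
all: have [N nE] : exists N, n = (2 * N + 1)%N.
1,3: by exists n./2; rewrite -{1}(odd_double_half n) n_odd; lia.
all: have tot : (totient n).+1 != 1%N by rewrite eqSS -lt0n totient_gt0; lia.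
all: have N_gt0 : (0 < N)%N by lia.
(* The power of [q] is a square, so the whole right-hand side takes the form [R ^+ 2] of the local
   congruences. *)
all: have exp_half : ((n - 1) ^ 2 = 2 * N ^ 2 * 2)%N by rewrite nE; nia.
all: have half : ((n - 1) %/ 2 = N)%N by rewrite nE addnK mulKn.
all: rewrite exp_half half (exprM q) -!exprMn.
- have sP : size (PhiN n) != 1%N by rewrite size_PhiN.
  subst n.
  apply: double_sum_eqmod3 => //.
  + by apply: adic_unit_iota => //; apply: coprime_X_PhiN.
  + rewrite -(rmorph1 iota) -rmorphD; apply: adic_unit_iota => //.
    exact: coprime_X1_PhiN.
  + rewrite -rmorphXn -(rmorph1 iota) -rmorphB; apply: adic_iota.
    exact: dvdp_PhiN_double.
  + move=> m nm; rewrite -rmorphXn -(rmorph1 iota) -rmorphB; apply: adic_unit_iota => //.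
    exact: coprime_Xn_PhiN.
  + rewrite -rmorphXn -(rmorph1 iota) -rmorphD; apply: adic_iota.
    exact: dvdp_PhiN.
- have sP : size (Phi n) != 1%N by rewrite size_Phi.
  subst n.
  apply: double_sum_eqmod2 => //.
  + by apply: adic_unit_iota => //; apply: coprime_X_Phi.
  + rewrite -(rmorph1 iota) -rmorphD; apply: adic_unit_iota => //.
    exact: coprime_X1_Phi.
  + rewrite -rmorphXn -(rmorph1 iota) -rmorphB; apply: adic_iota.
    exact: dvdp_Phi_double.
  + move=> m nm; rewrite -rmorphXn -(rmorph1 iota) -rmorphB; apply: adic_unit_iota => //.
    exact: coprime_Xn_Phi.
Qed.

End Adic.

Theorem theorem1p1 (n : nat) (n_gt1 : (1 < n)%N) (n_odd : odd n) :
  let q := qvar in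
  ratfun_congr (PhiN n ^+ 3 * Phi n ^+ 2)
    (\sum_(k < n) \sum_(j < k.+1) cq j * cq (k - j))
    (qint (q ^+ 2) n ^+ 2 * q ^+ ((n - 1) ^ 2) *
     (\sum_(k < ((n - 1) %/ 2).+1)
        qpoch (q ^+ 2) (q ^+ 4) k /
        (qint q (4 * k + 1) * qpoch (q ^+ 4) (q ^+ 4) k) * q ^+ (2 * k)) ^+ 2).
Proof.
have inj : injective (@tofrac {poly rat}) by move=> u v /eqP; rewrite tofrac_eq => /eqP.
exact: (double_sum_reduced _ _ inj n n_gt1 n_odd).
Qed.
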